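(* Fix $r_0\in(0,\tfrac23)$, $\alpha\in[0,1)$, and $(\lambda,\mu)\in(0,a_0]^2$ with $a_0=a_0(r_0)$ as in the existence theorem stated in the context. For every $\varepsilon\in(0,1)$ let $(u_\varepsilon,v_\varepsilon,\varphi_\varepsilon)$ be a solution of $(\mathrm P_{\varepsilon,\lambda,\mu})$ having all the properties listed in that existence theorem (regularity, evenness, convexity of $u_\varepsilon$ and $-v_\varepsilon$, $|\partial_x^2u_\varepsilon|,|\partial_x^2v_\varepsilon|\le r_0$, the bounds $0\ge u_\varepsilon\ge-\frac13+\kappa_0$, $-\frac13-2\kappa_0\ge v_\varepsilon\ge -1$ with $\kappa_0\in(0,\frac13)$ independent of $\varepsilon$, and $\|u_\varepsilon\|_{W^2_\infty},\|v_\varepsilon\|_{W^2_\infty}\le3$). Then there exist a null sequence $(\varepsilon_k)_{k\ge1}\subset(0,1)$ and functions $u_0,v_0\in W^2_\infty(-1,1)$ solving the small aspect ratio equations $$u_0''=\frac{\lambda}{(u_0-v_0)^2},\quad u_0(\pm1)=0,\qquad v_0''=-\frac{\mu}{(u_0-v_0)^2},\quad v_0(\pm1)=-1,$$ on $(-1,1)$, with $v_0<u_0$, such that $u_{\varepsilon_k}\to u_0$ and $v_{\varepsilon_k}\to v_0$ in $W^1_\infty(-1,1)$ and $$\varphi_{\varepsilon_k}\mathbf 1_{\Omega_{u_{\varepsilon_k},v_{\varepsilon_k}}}\to\varphi_0\mathbf 1_{\Omega_{u_0,v_0}}\quad\text{in }L_2((-1,1)\times(-1,0))$$ as $k\to\infty$,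 where $\varphi_0(x,z)=\frac{z-v_0(x)}{u_0(x)-v_0(x)}$.
   Context: For functions $u,v\in W^2_\infty(-1,1)$ with $v<u$ on $[-1,1]$, let $\Omega_{u,v}=\{(x,z)\in(-1,1)\times\mathbb R:\ v(x)<z<u(x)\}$, $\Gamma_u=\{(x,u(x)):x\in(-1,1)\}$ and $\Gamma_v=\{(x,v(x)):x\in(-1,1)\}$. For $\varepsilon>0$ write $\nabla_\varepsilon=(\varepsilon\partial_x,\partial_z)$ and $\Delta_\varepsilon=\varepsilon^2\partial_x^2+\partial_z^2$. For parameters $\varepsilon,\lambda,\mu>0$, the problem $(\mathrm P_{\varepsilon,\lambda,\mu})$ consists in finding $(u,v,\varphi)$ with $u,v\in W^2_\infty(-1,1)$, $v<u$, and $\varphi$ on $\overline{\Omega_{u,v}}$ such that $\Delta_\varepsilon\varphi=0$ in $\Omega_{u,v}$; $\varphi(x,z)=\frac{z-v(x)}{u(x)-v(x)}$ on $\partial\Omega_{u,v}$; $\partial_x^2u(x)=\lambda\,|\nabla_\varepsilon\varphi(x,u(x))|^2$ for $x\in(-1,1)$; $\partial_x^2v(x)=-\mu\,|\nabla_\varepsilon\varphi(x,v(x))|^2$ for $x\in(-1,1)$; $u(\pm1)=0$; $v(\pm1)=-1$. Existence theorem (assumed): for every $\varepsilon\in(0,1)$, $r_0\in(0,\frac23)$, $\alpha\in[0,1)$ there is $a_0=a_0(r_0)>0$ such that for every $(\lambda,\mu)\in(0,a_0]^2$ the problem $(\mathrm P_{\varepsilon,\lambda,\mu})$ has a solution with $u,v\in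 C^{2+\alpha}([-1,1])$, $\varphi\in W^2_2(\Omega_{u,v})\cap C(\overline{\Omega_{u,v}})\cap C^{2+\alpha}(\Omega_{u,v}\cup\Gamma_u\cup\Gamma_v)$ and the properties listed in the claim. $\mathbf 1_A$ denotes the characteristic function of $A\subset\mathbb R^2$; functions multiplied by $\mathbf 1_A$ are extended by zero outside $A$. *)

(* Defs.v *)
From Stdlib Require Import Reals Lra.
Open Scope R_scope.

Definition in_I (x : R) : Prop := -1 <= x <= 1.
Definition in_oI (x : R) : Prop := -1 < x < 1.

Definition cont_on_I (f : R -> R) : Prop :=
  forall x, in_I x -> forall eta, 0 < eta -> exists delta, 0 < delta /\
    forall y, in_I y -> Rabs (y - x) < delta -> Rabs (f y - f x) < eta.

Definition C2_on_I (f f1 f2 : R -> R) : Prop :=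
  cont_on_I f /\ cont_on_I f1 /\ cont_on_I f2 /\
  forall x, in_oI x -> derivable_pt_lim f x (f1 x) /\ derivable_pt_lim f1 x (f2 x).

Definition holder_on_I (alpha : R) (f : R -> R) : Prop :=
  exists C, forall x y, in_I x -> in_I y ->
    Rabs (f x - f y) <= C * Rpower (Rabs (x - y)) alpha.

Definition convex_on_I (f : R -> R) : Prop :=
  forall x y t, in_I x -> in_I y -> 0 <= t <= 1 ->
    f (t * x + (1 - t) * y) <= t * f x + (1 - t) * f y.

Definition in_Omega (u v : R -> R) (x z : R) : Prop := in_oI x /\ v x < z < u x.
Definition in_clOmega (u v : R -> R) (x z : R) : Prop := in_I x /\ v x <= z <= u x.
Definition on_bdry (u v : R -> R) (x z : R) : Prop :=
  in_clOmega u v x z /\ (x = -1 \/ x = 1 \/ z = u x \/ z = v x).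
Definition in_OmegaG (u v : R -> R) (x z : R) : Prop :=
  in_Omega u v x z \/ (in_oI x /\ (z = u x \/ z = v x)).

Definition cont2_on (S : R -> R -> Prop) (f : R -> R -> R) : Prop :=
  forall x z, S x z -> forall eta, 0 < eta -> exists delta, 0 < delta /\
    forall x' z', S x' z' -> Rabs (x' - x) < delta -> Rabs (z' - z) < delta ->
      Rabs (f x' z' - f x z) < eta.

Definition ind_Omega (u v : R -> R) (x z : R) : R :=
  if Rlt_dec (-1) x then
    if Rlt_dec x 1 then
      if Rlt_dec (v x) z then
        if Rlt_dec z (u x) then 1 else 0
      else 0
    else 0
  else 0.

(* (u,v,phi) solves (P_{eps,lam,mu}); u1,u2 (v1,v2) are the first and second
   derivatives of u (v).  phi is C^2 in Omega (pure second partials continuous),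
   its first partials extend continuously to Omega u Gamma_u u Gamma_v, and phi is
   continuous on the closure of Omega. *)
Definition is_solution (eps lam mu : R) (u u1 u2 v v1 v2 : R -> R)
    (phi : R -> R -> R) : Prop :=
  C2_on_I u u1 u2 /\ C2_on_I v v1 v2 /\ (forall x, in_I x -> v x < u x) /\
  cont2_on (in_clOmega u v) phi /\
  (forall x z, on_bdry u v x z -> phi x z = (z - v x) / (u x - v x)) /\
  (exists px pz pxx pzz : R -> R -> R,
     (forall x z, in_Omega u v x z ->
        derivable_pt_lim (fun t => phi t z) x (px x z) /\
        derivable_pt_lim (fun t => phi x t) z (pz x z) /\
        derivable_pt_lim (fun t => px t z) x (pxx x z) /\
        derivable_pt_lim (fun t => pz x t) z (pzz x z) /\
        eps ^ 2 * pxx x z + pzz x z = 0) /\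
     cont2_on (in_Omega u v) pxx /\ cont2_on (in_Omega u v) pzz /\
     cont2_on (in_OmegaG u v) px /\ cont2_on (in_OmegaG u v) pz /\
     (forall x, in_oI x ->
        u2 x = lam * (eps ^ 2 * (px x (u x)) ^ 2 + (pz x (u x)) ^ 2)) /\
     (forall x, in_oI x ->
        v2 x = - mu * (eps ^ 2 * (px x (v x)) ^ 2 + (pz x (v x)) ^ 2))) /\
  u (-1) = 0 /\ u 1 = 0 /\ v (-1) = -1 /\ v 1 = -1.

Definition sol_props (r0 alpha kappa0 : R) (u u1 u2 v v1 v2 : R -> R) : Prop :=
  holder_on_I alpha u2 /\ holder_on_I alpha v2 /\
  (forall x, in_I x -> u (- x) = u x /\ v (- x) = v x) /\
  convex_on_I u /\ convex_on_I (fun x => - v x) /\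
  (forall x, in_oI x -> Rabs (u2 x) <= r0 /\ Rabs (v2 x) <= r0) /\
  (forall x, in_I x -> 0 >= u x /\ u x >= -1/3 + kappa0 /\
                       -1/3 - 2 * kappa0 >= v x /\ v x >= -1) /\
  (forall x, in_oI x ->
     Rabs (u x) <= 3 /\ Rabs (u1 x) <= 3 /\ Rabs (u2 x) <= 3 /\
     Rabs (v x) <= 3 /\ Rabs (v1 x) <= 3 /\ Rabs (v2 x) <= 3).

Definition small_aspect_sol (lam mu : R) (u0 u01 u02 v0 v01 v02 : R -> R) : Prop :=
  cont_on_I u0 /\ cont_on_I v0 /\
  (forall x, in_oI x ->
     derivable_pt_lim u0 x (u01 x) /\ derivable_pt_lim u01 x (u02 x) /\
     derivable_pt_lim v0 x (v01 x) /\ derivable_pt_lim v01 x (v02 x)) /\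
  (exists M, forall x, in_oI x ->
     Rabs (u01 x) <= M /\ Rabs (u02 x) <= M /\ Rabs (v01 x) <= M /\ Rabs (v02 x) <= M) /\
  (forall x, in_oI x ->
     u02 x = lam / (u0 x - v0 x) ^ 2 /\ v02 x = - mu / (u0 x - v0 x) ^ 2) /\
  u0 (-1) = 0 /\ u0 1 = 0 /\ v0 (-1) = -1 /\ v0 1 = -1 /\
  (forall x, in_I x -> v0 x < u0 x).

(* convergence in W^1_inf(-1,1) (functions are C^1, so ess sup = sup) *)
Definition W1inf_cv (f f1 : nat -> R -> R) (g g1 : R -> R) : Prop :=
  forall eta, 0 < eta -> exists N, forall k, (N <= k)%nat -> forall x, in_oI x ->
    Rabs (f k x - g x) <= eta /\ Rabs (f1 k x - g1 x) <= eta.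

Definition iter_int_le (F : R -> R -> R) (a b c d eta : R) : Prop :=
  exists G : R -> R,
    (forall x, a <= x <= b ->
       exists pr : Riemann_integrable (F x) c d, RiemannInt pr = G x) /\
    (exists pr : Riemann_integrable G a b, RiemannInt pr <= eta).

Definition L2_cv (F : nat -> R -> R -> R) (G : R -> R -> R) : Prop :=
  forall eta, 0 < eta -> exists N, forall k, (N <= k)%nat ->
    iter_int_le (fun x z => (F k x z - G x z) ^ 2) (-1) 1 (-1) 0 eta.

(* Main.v *)
(** The linear interpolation [psi = (z - v) / (u - v)] matches [phi] on the whole boundary and
    is harmonic up to an error [O(eps^2)], because [|u''|], [|v''|] and [1 / (u - v)] are bounded
    uniformly in [eps].  The maximum principle with barrier [K eps^2 (z - v) (u - z)] bounds
    [phi - psi] by that barrier.  Since the barrier vanishes linearly on the curved boundary, this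
    controls the traces of [grad phi] as well, and the free boundary conditions become
    [u'' = lam / (u - v)^2 + O(eps^2)] and [v'' = - mu / (u - v)^2 + O(eps^2)] uniformly in [x].
    By evenness [u'(0) = v'(0) = 0], so Gronwall's inequality shows that the profiles depend
    continuously in [C^1] on the two numbers [u(0)], [v(0)]; along a sequence for which these
    converge, everything converges uniformly, without appealing to the Arzela-Ascoli theorem. *)

Require Import Defs.
From Stdlib Require Import Reals Ranalysis5 Lra Lia Classical_Prop IndefiniteDescription.
From Coquelicot Require Import Coquelicot.
Open Scope R_scope.

(** * Clamping *)

(** The curvature laws evaluate the gradient on the free boundary, whereas the derivatives of [phi]
    are tied to [phi] only inside the open domain; on the curves the partials are merely continuous
    extensions. Trace bounds are therefore read off from mean value quotients at interior points,
    where the barrier is comparable to the distance from the curve, and then passed to the boundary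
    by continuity. All constants depend only on the gap [m = 3 * kappa0], the distance between the
    bounds that separate [u] from [v], so they are independent of [eps]. Limits are produced by
    comparing two members of the sequence with each other, not with a known solution, and since the
    second derivatives converge uniformly too, the limit equations hold classically. For the
    potentials the cut-off functions are discontinuous; integrability of the iterated integral comes
    from writing every slice integral through integrals of continuous functions with moving
    limits. *)

Definition clamp (a b x : R) : R := Rmax a (Rmin b x).

Lemma clamp_in (a b x : R) : a <= b -> a <= clamp a b x <= b.
Proof.
  intros H; unfold clamp, Rmax, Rmin.
  destruct (Rle_dec b x); destruct (Rle_dec a _); lra.
Qed.

Lemma clamp_id (a b x : R) : a <= x <= b -> clamp a b x = x.
Proof.
  intros H; unfold clamp, Rmax, Rmin.
  destruct (Rle_dec b x); destruct (Rle_dec a _); lra.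
Qed.

Lemma clamp_near (a b x a' b' x' d : R) :
  Rabs (a' - a) < d -> Rabs (b' - b) < d -> Rabs (x' - x) < d ->
  Rabs (clamp a' b' x' - clamp a b x) < d.
Proof.
  intros Ha Hb Hx.
  apply Rabs_def2 in Ha, Hb, Hx.
  unfold clamp, Rmax, Rmin.
  destruct (Rle_dec b x); destruct (Rle_dec b' x');
  destruct (Rle_dec a _); destruct (Rle_dec a' _); apply Rabs_def1; lra.
Qed.

Definition clampI (x : R) : R := clamp (-1) 1 x.

Lemma clampI_in (x : R) : in_I (clampI x).
Proof. apply clamp_in; lra. Qed.

Lemma clampI_id (x : R) : in_I x -> clampI x = x.
Proof. apply clamp_id. Qed.

Lemma clampI_near (x x' d : R) : Rabs (x' - x) < d -> Rabs (clampI x' - clampI x) < d.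
Proof.
  intros H.
  assert (0 < d) by (pose proof (Rabs_pos (x' - x)); lra).
  apply clamp_near; trivial; rewrite Rminus_eq_0, Rabs_R0; trivial.
Qed.

Definition clamp_fun (f : R -> R) (x : R) : R := f (clampI x).

Lemma clamp_fun_near (f : R -> R) : cont_on_I f -> forall x eta, 0 < eta ->
  exists d, 0 < d /\ forall x', Rabs (x' - x) < d ->
    Rabs (clamp_fun f x' - clamp_fun f x) < eta.
Proof.
  intros Hf x eta He.
  destruct (Hf (clampI x) (clampI_in x) eta He) as (d & Hd & H).
  exists d; split; trivial; intros x' Hx'.
  apply H; [apply clampI_in | apply clampI_near, Hx'].
Qed.

Lemma clamp_fun_continuity (f : R -> R) : cont_on_I f -> forall x, continuity_pt (clamp_fun f) x.
Proof.
  intros Hf x eta He.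
  destruct (clamp_fun_near f Hf x eta He) as (d & Hd & H).
  exists d; split; trivial.
  intros x' [_ Hx']; apply H, Hx'.
Qed.

(** This is composition with a continuous retraction of the plane onto the closed domain. It makes
    results on functions continuous in the whole plane available for functions known only there. *)
Definition clamp_fun2 (u v : R -> R) (f : R -> R -> R) (x z : R) : R :=
  f (clampI x) (clamp (clamp_fun v x) (clamp_fun u x) z).

Lemma clamp_fun2_in (u v : R -> R) (x z : R) :
  (forall x, in_I x -> v x <= u x) ->
  in_clOmega u v (clampI x) (clamp (clamp_fun v x) (clamp_fun u x) z).
Proof.
  intros H; split; [apply clampI_in|].
  apply clamp_in, H, clampI_in.
Qed.

Lemma clamp_fun2_id (u v : R -> R) (f : R -> R -> R) (x z : R) :
  in_clOmega u v x z -> clamp_fun2 u v f x z = f x z.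
Proof.
  intros [Hx Hz]; unfold clamp_fun2, clamp_fun.
  rewrite (clampI_id x Hx), clamp_id; trivial.
Qed.

Lemma clamp_fun2_continuity (u v : R -> R) (f : R -> R -> R) :
  cont_on_I u -> cont_on_I v -> (forall x, in_I x -> v x <= u x) ->
  cont2_on (in_clOmega u v) f ->
  forall x z, continuity_2d_pt (clamp_fun2 u v f) x z.
Proof.
  intros Hu Hv Hle Hf x z [eta He].
  destruct (Hf _ _ (clamp_fun2_in u v x z Hle) eta He) as (d & Hd & H).
  destruct (clamp_fun_near u Hu x d Hd) as (du & Hdu & Ku).
  destruct (clamp_fun_near v Hv x d Hd) as (dv & Hdv & Kv).
  assert (Hm : 0 < Rmin d (Rmin du dv)) by (repeat apply Rmin_glb_lt; trivial).
  exists (mkposreal _ Hm); simpl; intros x' z' Hx' Hz'.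
  assert (M1 := Rmin_l d (Rmin du dv)).
  assert (M2 := Rmin_r d (Rmin du dv)).
  assert (M3 := Rmin_l du dv).
  assert (M4 := Rmin_r du dv).
  apply H.
  - apply clamp_fun2_in, Hle.
  - apply clampI_near; lra.
  - apply clamp_near; [apply Kv | apply Ku |]; lra.
Qed.

(** * Maximum principle *)

(** Maximise first in [z], choosing a maximiser [s x], then in [x]. The selection [s] may jump, but
    the marginal maximum is continuous: testing each of two nearby maximisers in the other slice
    costs less than [eta] by uniform continuity. *)
Lemma rectangle_max (f : R -> R -> R) (a b c d : R) : a <= b -> c <= d ->
  (forall x z, continuity_2d_pt f x z) ->
  exists x0 z0, a <= x0 <= b /\ c <= z0 <= d /\
    forall x z, a <= x <= b -> c <= z <= d -> f x z <= f x0 z0.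
Proof.
  intros Hab Hcd Hf.
  assert (Hz : forall x, exists z0, c <= z0 <= d /\ forall z, c <= z <= d -> f x z <= f x z0).
  { intros x.
    destruct (continuity_ab_maj (f x) c d Hcd) as (z0 & H1 & H2).
    - intros z _ eta He.
      destruct (Hf x z (mkposreal eta He)) as [delta Hdelta].
      exists delta; split; [apply cond_pos|].
      intros z' [_ Hz']; apply Hdelta; [|apply Hz'].
      rewrite Rminus_eq_0, Rabs_R0; apply cond_pos.
    - exists z0; split; [trivial|]. intros z Hz; apply H1, Hz. }
  destruct (functional_choice _ Hz) as [s Hs].
  assert (Hm : forall x, a - 1 <= x <= b + 1 -> continuity_pt (fun x => f x (s x)) x).
  { intros x Hx eta He.
    destruct (uniform_continuity_2d f (a - 2) (b + 2) c d (fun x z _ _ => Hf x z) (mkposreal eta He))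
      as [delta H]; simpl in H.
    assert (Hd : 0 < Rmin delta 1) by (apply Rmin_glb_lt; [apply cond_pos | lra]).
    exists (Rmin delta 1); split; [exact Hd|].
    intros x' [_ Hx']; simpl in Hx' |- *; unfold R_dist in *.
    assert (M1 := Rmin_l delta 1). assert (M2 := Rmin_r delta 1).
    destruct (Hs x) as [Sx Mx]. destruct (Hs x') as [Sx' Mx'].
    assert (X' := Rabs_def2 _ _ Hx').
    assert (Z0 : forall z, Rabs (z - z) < delta)
      by (intros z; rewrite Rminus_eq_0, Rabs_R0; apply cond_pos).
    assert (A1 := H x (s x) x' (s x)).
    assert (A2 := H x (s x') x' (s x')).
    assert (B1 := Mx (s x') Sx'). assert (B2 := Mx' (s x) Sx).
    assert (A1' : Rabs (f x' (s x) - f x (s x)) < eta) by (apply A1; trivial; lra).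
    assert (A2' : Rabs (f x' (s x') - f x (s x')) < eta) by (apply A2; trivial; lra).
    apply Rabs_def2 in A1', A2'. apply Rabs_def1; lra. }
  destruct (continuity_ab_maj (fun x => f x (s x)) a b Hab) as (x0 & H1 & H2).
  - intros x Hx; apply Hm; lra.
  - exists x0, (s x0); split; [trivial|]; split; [apply Hs|].
    intros x z Hx Hz'. apply Rle_trans with (f x (s x)); [apply Hs, Hz' | apply H1, Hx].
Qed.

(** Fermat gives [f1 x = 0]. If [l] were positive, [f1] would be positive just to the right of [x],
    whereas the mean value theorem on [[x, x + h]] produces a point there with [f1] nonpositive. *)
Lemma local_max_second_derivative (f f1 : R -> R) (x l : R) :
  (exists d, 0 < d /\ forall t, Rabs (t - x) < d -> f t <= f x /\ derivable_pt_lim f t (f1 t)) ->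
  derivable_pt_lim f1 x l -> l <= 0.
Proof.
  intros (d & Hd & H) Hl.
  assert (H0 : f1 x = 0).
  { assert (Hx : Rabs (x - x) < d) by (rewrite Rminus_eq_0, Rabs_R0; lra).
    pose (pr := exist (fun l => derivable_pt_abs f x l) (f1 x) (proj2 (H x Hx)) : derivable_pt f x).
    change (derive_pt f x pr = 0).
    apply (deriv_maximum f (x - d) (x + d)); try lra.
    intros t H1 H2; apply H, Rabs_def1; lra. }
  destruct (Rle_lt_dec l 0) as [|Hpos]; trivial; exfalso.
  destruct (Hl (l / 2)) as [delta Hdelta]; [lra|].
  set (h := Rmin d delta / 2).
  assert (Hh : 0 < h /\ h < d /\ h < delta).
  { assert (M1 := Rmin_l d delta). assert (M2 := Rmin_r d delta).
    assert (0 < Rmin d delta) by (apply Rmin_glb_lt; [lra | apply cond_pos]).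
    unfold h; lra. }
  destruct (MVT_cor2 f f1 x (x + h)) as (c & Hc & Hxc); [lra| |].
  - intros t Ht; apply H, Rabs_def1; lra.
  - destruct (H (x + h)) as [Hle _]; [apply Rabs_def1; lra|].
    assert (Hc1 : f1 c <= 0) by nra.
    assert (Hq : Rabs ((f1 (x + (c - x)) - f1 x) / (c - x) - l) < l / 2).
    { apply Hdelta; [lra | apply Rabs_def1; lra]. }
    replace (x + (c - x)) with c in Hq by ring. rewrite H0 in Hq.
    apply Rabs_def2 in Hq.
    assert (f1 c - 0 = (f1 c - 0) / (c - x) * (c - x)) by (field; lra).
    nra.
Qed.

Lemma cont_on_I_open (f : R -> R) (x a b : R) : cont_on_I f -> in_oI x -> a < f x < b ->
  exists d, 0 < d /\ forall t, Rabs (t - x) < d -> in_oI t /\ a < f t < b.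
Proof.
  intros Hf Hx Hz.
  assert (HI : in_I x) by (unfold in_I, in_oI in *; lra).
  destruct (Hf x HI (Rmin (f x - a) (b - f x))) as (d & Hd & H);
    [apply Rmin_glb_lt; lra|].
  exists (Rmin d (Rmin (x + 1) (1 - x))).
  split; [unfold in_oI in Hx; repeat apply Rmin_glb_lt; lra|].
  intros t Ht.
  assert (M1 := Rmin_l d (Rmin (x + 1) (1 - x))). assert (M2 := Rmin_r d (Rmin (x + 1) (1 - x))).
  assert (M3 := Rmin_l (x + 1) (1 - x)). assert (M4 := Rmin_r (x + 1) (1 - x)).
  assert (M5 := Rmin_l (f x - a) (b - f x)). assert (M6 := Rmin_r (f x - a) (b - f x)).
  assert (T := Rabs_def2 _ _ Ht).
  assert (Ht' : in_oI t) by (unfold in_oI in *; lra).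
  split; trivial.
  assert (HH : Rabs (f t - f x) < Rmin (f x - a) (b - f x))
    by (apply H; [unfold in_I, in_oI in *; lra | lra]).
  apply Rabs_def2 in HH; lra.
Qed.

Lemma in_Omega_open (u v : R -> R) (x z : R) :
  cont_on_I u -> cont_on_I v -> in_Omega u v x z ->
  exists d, 0 < d /\ forall t, Rabs (t - x) < d -> in_Omega u v t z.
Proof.
  intros Hu Hv [Hx Hz].
  destruct (cont_on_I_open u x z (u x + 1) Hu Hx) as (d1 & Hd1 & H1); [lra|].
  destruct (cont_on_I_open v x (v x - 1) z Hv Hx) as (d2 & Hd2 & H2); [lra|].
  exists (Rmin d1 d2); split; [apply Rmin_glb_lt; trivial|].
  intros t Ht.
  assert (M1 := Rmin_l d1 d2). assert (M2 := Rmin_r d1 d2).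
  destruct (H1 t) as [A B]; [lra|]. destruct (H2 t) as [_ C]; [lra|].
  split; [trivial | lra].
Qed.

(** A positive maximum would lie off the boundary, where both second derivatives are nonpositive,
    against the strict sign of the operator. The strict sign replaces the usual perturbation
    argument; the barrier will supply it. *)
Lemma maximum_principle (u v : R -> R) (e c d : R) (D Dx Dz Dxx Dzz : R -> R -> R) :
  cont_on_I u -> cont_on_I v -> (forall x, in_I x -> v x < u x) ->
  (forall x, in_I x -> c <= v x /\ u x <= d) -> 0 <= e ->
  cont2_on (in_clOmega u v) D ->
  (forall x z, in_Omega u v x z ->
     derivable_pt_lim (fun t => D t z) x (Dx x z) /\
     derivable_pt_lim (fun t => D x t) z (Dz x z) /\
     derivable_pt_lim (fun t => Dx t z) x (Dxx x z) /\
     derivable_pt_lim (fun t => Dz x t) z (Dzz x z) /\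
     0 < e * Dxx x z + Dzz x z) ->
  (forall x z, on_bdry u v x z -> D x z <= 0) ->
  forall x z, in_clOmega u v x z -> D x z <= 0.
Proof.
  intros Hu Hv Hlt Hcd He HD HL Hb x z Hxz.
  assert (Hle : forall x, in_I x -> v x <= u x) by (intros y Hy; apply Rlt_le, Hlt, Hy).
  destruct (rectangle_max (clamp_fun2 u v D) (-1) 1 c d) as (x0 & z0 & _ & _ & Hmax).
  - lra.
  - destruct Hxz as [Hx Hz]; destruct (Hcd x Hx); lra.
  - apply clamp_fun2_continuity; trivial.
  - assert (Hin := clamp_fun2_in u v x0 z0 Hle).
    (* Projecting the maximiser of the extension back to the closed domain gives a maximiser of [D]
       itself. *)
    unfold clamp_fun2 at 2 in Hmax.
    set (xm := clampI x0) in *. set (zm := clamp _ _ z0) in *.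
    assert (Hmax' : forall x z, in_clOmega u v x z -> D x z <= D xm zm).
    { intros x' z' H'. rewrite <- (clamp_fun2_id u v D x' z' H').
      destruct H' as [Hx' Hz']; apply Hmax; [exact Hx'|]. destruct (Hcd x' Hx'); lra. }
    apply Rle_trans with (D xm zm); [apply Hmax', Hxz|].
    destruct (Rle_lt_dec (D xm zm) 0) as [|Hpos]; trivial; exfalso.
    assert (Hint : in_Omega u v xm zm).
    { destruct Hin as [Hi1 Hi2].
      assert (Hnb : ~ (xm = -1 \/ xm = 1 \/ zm = u xm \/ zm = v xm)).
      { intros Hor. assert (on_bdry u v xm zm) by (split; [split|]; trivial).
        specialize (Hb _ _ H); lra. }
      unfold in_I in Hi1.
      assert (xm <> -1) by tauto. assert (xm <> 1) by tauto.
      assert (zm <> u xm) by tauto. assert (zm <> v xm) by tauto.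
      split; [unfold in_oI; lra | lra]. }
    assert (Hcl : forall x z, in_Omega u v x z -> in_clOmega u v x z).
    { intros x' z' [H1 H2]; split; [unfold in_I, in_oI in *; lra | lra]. }
    destruct (HL _ _ Hint) as (_ & _ & Hxx & Hzz & Hell).
    assert (Dxx xm zm <= 0).
    { apply (local_max_second_derivative (fun t => D t zm) (fun t => Dx t zm) xm); trivial.
      destruct (in_Omega_open u v xm zm Hu Hv Hint) as (dl & Hdl & H).
      exists dl; split; trivial. intros t Ht; split; [apply Hmax', Hcl, H, Ht | apply HL, H, Ht]. }
    assert (Dzz xm zm <= 0).
    { apply (local_max_second_derivative (fun t => D xm t) (fun t => Dz xm t) zm); trivial.
      destruct Hint as [Hi1 Hi2].
      exists (Rmin (zm - v xm) (u xm - zm)); split; [apply Rmin_glb_lt; lra|].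
      assert (M1 := Rmin_l (zm - v xm) (u xm - zm)). assert (M2 := Rmin_r (zm - v xm) (u xm - zm)).
      intros t Ht; apply Rabs_def2 in Ht.
      assert (in_Omega u v xm t) by (split; [trivial | lra]).
      split; [apply Hmax', Hcl; trivial | apply HL; trivial]. }
    nra.
Qed.

(** * The potential is close to the linear interpolation *)

Lemma Rabs_mult_le (a b A B : R) : Rabs a <= A -> Rabs b <= B -> Rabs (a * b) <= A * B.
Proof. intros; rewrite Rabs_mult; apply Rmult_le_compat; auto using Rabs_pos. Qed.

Lemma Rabs_plus_le (a b A B : R) : Rabs a <= A -> Rabs b <= B -> Rabs (a + b) <= A + B.
Proof. intros; apply Rle_trans with (1 := Rabs_triang a b); lra. Qed.

Lemma Rabs_minus_le (a b A B : R) : Rabs a <= A -> Rabs b <= B -> Rabs (a - b) <= A + B.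
Proof. intros; apply Rabs_plus_le; [|rewrite Rabs_Ropp]; trivial. Qed.

Ltac rabs := repeat match goal with
  | |- Rabs (- _) <= _ => rewrite Rabs_Ropp
  | |- Rabs (_ + _) <= _ + _ => apply Rabs_plus_le
  | |- Rabs (_ - _) <= _ + _ => apply Rabs_minus_le
  | |- Rabs (_ * _) <= _ * _ => apply Rabs_mult_le
  end.

(** The class over which all estimates are uniform: 3 is the a priori bound on the derivatives, and
    [m <= 1] lets lower powers of [/ m] be absorbed by higher ones. *)
Definition profile (m : R) (u u1 u2 v v1 v2 : R -> R) : Prop :=
  0 < m <= 1 /\ C2_on_I u u1 u2 /\ C2_on_I v v1 v2 /\
  (forall x, in_I x -> -1 <= v x /\ u x <= 0 /\ m <= u x - v x) /\
  (forall x, in_oI x -> Rabs (u1 x) <= 3 /\ Rabs (u2 x) <= 3 /\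
                        Rabs (v1 x) <= 3 /\ Rabs (v2 x) <= 3).

Definition psi (u v : R -> R) (x z : R) : R := (z - v x) / (u x - v x).

Definition bump (u v : R -> R) (x z : R) : R := (z - v x) * (u x - z).

Lemma in_oI_in_I (x : R) : in_oI x -> in_I x.
Proof. unfold in_oI, in_I; lra. Qed.

Lemma derivable_pt_lim_eq (f : R -> R) (x l l' : R) :
  derivable_pt_lim f x l' -> l' = l -> derivable_pt_lim f x l.
Proof. intros H <-; exact H. Qed.

Definition psi_xx (u u1 u2 v v1 v2 : R -> R) (x z : R) : R :=
  - v2 x * / (u x - v x) + 2 * v1 x * (u1 x - v1 x) * / (u x - v x) ^ 2
  + (z - v x) * (2 * (u1 x - v1 x) ^ 2 * / (u x - v x) ^ 3 - (u2 x - v2 x) * / (u x - v x) ^ 2).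

Lemma psi_derive (u u1 u2 v v1 v2 : R -> R) (x z : R) :
  derivable_pt_lim u x (u1 x) -> derivable_pt_lim u1 x (u2 x) ->
  derivable_pt_lim v x (v1 x) -> derivable_pt_lim v1 x (v2 x) ->
  u x - v x <> 0 ->
  let psi_x := fun x z =>
    - v1 x * / (u x - v x) - (z - v x) * (u1 x - v1 x) * / (u x - v x) ^ 2 in
  derivable_pt_lim (fun t => psi u v t z) x (psi_x x z) /\
  derivable_pt_lim (fun t => psi u v x t) z (/ (u x - v x)) /\
  derivable_pt_lim (fun t => psi_x t z) x (psi_xx u u1 u2 v v1 v2 x z).
Proof.
  intros Hu Hu1 Hv Hv1 Hw psi_x.
  apply is_derive_Reals in Hu, Hu1, Hv, Hv1.
  repeat split; apply is_derive_Reals; unfold psi, psi_x, psi_xx.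
  - auto_derive.
    + repeat split; trivial; [exists (v1 x) | exists (u1 x) | exists (v1 x)]; trivial.
    + change (fun x0 => v x0) with v; change (fun x0 => u x0) with u.
      rewrite (is_derive_unique _ _ _ Hu), (is_derive_unique _ _ _ Hv); field; trivial.
  - auto_derive; trivial; field; trivial.
  - auto_derive.
    + repeat split; trivial; try solve [exists (v1 x); trivial]; try solve [exists (v2 x); trivial];
      try solve [exists (u1 x); trivial]; try solve [exists (u2 x); trivial].
      apply Rmult_integral_contrapositive_currified; trivial.
      apply Rmult_integral_contrapositive_currified; trivial; lra.
    + change (fun x0 => v x0) with v; change (fun x0 => u x0) with u.
      change (fun x0 => v1 x0) with v1; change (fun x0 => u1 x0) with u1.
      rewrite (is_derive_unique _ _ _ Hu), (is_derive_unique _ _ _ Hv).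
      rewrite (is_derive_unique _ _ _ Hu1), (is_derive_unique _ _ _ Hv1); field; trivial.
Qed.

(** With [0 <= z - v <= 1] the four terms are at most 3, 36, 72 and 6 times powers of [/ m] of
    degree at most 3; as [/ m >= 1], they add up to 117 times the cube. *)
Lemma psi_xx_bound (m : R) (u u1 u2 v v1 v2 : R -> R) (x z : R) :
  profile m u u1 u2 v v1 v2 -> in_Omega u v x z ->
  Rabs (psi_xx u u1 u2 v v1 v2 x z) <= 117 / m ^ 3.
Proof.
  intros (Hm & _ & _ & Hw & Hb) [Hx Hz].
  destruct (Hw x (in_oI_in_I x Hx)) as (W1 & W2 & W3).
  destruct (Hb x Hx) as (B1 & B2 & B3 & B4).
  assert (P3 : 0 < m ^ 3) by (apply pow_lt; lra).
  set (w := u x - v x) in *.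
  assert (Q : 0 < / w <= / m) by (split; [apply Rinv_0_lt_compat | apply Rinv_le_contravar]; lra).
  assert (Q1 : 1 <= / m) by (rewrite <- Rinv_1 at 1; apply Rinv_le_contravar; lra).
  assert (A : Rabs (/ w) <= / m) by (rewrite Rabs_pos_eq; lra).
  unfold psi_xx; fold w.
  rewrite <- !pow_inv.
  unfold Rdiv; rewrite <- pow_inv.
  set (q := / w) in *. set (Q0 := / m) in *.
  assert (A2 : Rabs (q ^ 2) <= Q0 ^ 2) by (rewrite <- RPow_abs; apply pow_incr; split; [apply Rabs_pos | trivial]).
  assert (A3 : Rabs (q ^ 3) <= Q0 ^ 3) by (rewrite <- RPow_abs; apply pow_incr; split; [apply Rabs_pos | trivial]).
  assert (D1 : Rabs (u1 x - v1 x) <= 3 + 3) by (apply Rabs_minus_le; trivial).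
  assert (D2 : Rabs (u2 x - v2 x) <= 3 + 3) by (apply Rabs_minus_le; trivial).
  assert (D3 : Rabs ((u1 x - v1 x) ^ 2) <= (3 + 3) * (3 + 3)).
  { replace ((u1 x - v1 x) ^ 2) with ((u1 x - v1 x) * (u1 x - v1 x)) by ring.
    apply Rabs_mult_le; trivial. }
  assert (T : Rabs 2 <= 2) by (rewrite Rabs_pos_eq; lra).
  assert (Z : Rabs (z - v x) <= 1) by (apply Rabs_le; lra).
  apply Rle_trans with
    (3 * Q0 + 2 * 3 * (3 + 3) * Q0 ^ 2 +
     1 * (2 * ((3 + 3) * (3 + 3)) * Q0 ^ 3 + (3 + 3) * Q0 ^ 2)).
  - rabs; trivial.
  - assert (Q0 ^ 1 <= Q0 ^ 3) by (apply Rle_pow; [trivial | lia]).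
    assert (Q0 ^ 2 <= Q0 ^ 3) by (apply Rle_pow; [trivial | lia]). lra.
Qed.

(** * Continuity and derivatives of the comparison functions *)

Lemma cont2_on_lincomb (S : R -> R -> Prop) (f g : R -> R -> R) (a b : R) :
  cont2_on S f -> cont2_on S g -> cont2_on S (fun x z => a * f x z + b * g x z).
Proof.
  intros Hf Hg x z Hxz eta He.
  set (k := Rabs a + Rabs b + 1).
  assert (Ka := Rabs_pos a). assert (Kb := Rabs_pos b).
  assert (Hk : 0 < eta / k) by (apply Rdiv_lt_0_compat; unfold k; lra).
  destruct (Hf x z Hxz _ Hk) as (d1 & Hd1 & H1).
  destruct (Hg x z Hxz _ Hk) as (d2 & Hd2 & H2).
  assert (M1 := Rmin_l d1 d2). assert (M2 := Rmin_r d1 d2).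
  exists (Rmin d1 d2); split; [apply Rmin_glb_lt; trivial|].
  intros x' z' HS Hx' Hz'.
  assert (F : Rabs (f x' z' - f x z) < eta / k) by (apply H1; trivial; lra).
  assert (G : Rabs (g x' z' - g x z) < eta / k) by (apply H2; trivial; lra).
  replace (a * f x' z' + b * g x' z' - (a * f x z + b * g x z))
    with (a * (f x' z' - f x z) + b * (g x' z' - g x z)) by ring.
  apply Rle_lt_trans with (Rabs a * (eta / k) + Rabs b * (eta / k)).
  - apply Rabs_plus_le; apply Rabs_mult_le; lra.
  - replace eta with (k * (eta / k)) at 3 by (field; unfold k; lra).
    set (q := eta / k) in *; unfold k; nra.
Qed.

Lemma cont2_on_mult (S : R -> R -> Prop) (f g : R -> R -> R) :
  cont2_on S f -> cont2_on S g -> cont2_on S (fun x z => f x z * g x z).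
Proof.
  intros Hf Hg x z Hxz eta He.
  set (k := Rabs (f x z) + Rabs (g x z) + 2).
  assert (Ka := Rabs_pos (f x z)). assert (Kb := Rabs_pos (g x z)).
  assert (Hk : 0 < Rmin 1 (eta / k))
    by (apply Rmin_glb_lt; [lra | apply Rdiv_lt_0_compat; unfold k; lra]).
  destruct (Hf x z Hxz _ Hk) as (d1 & Hd1 & H1).
  destruct (Hg x z Hxz _ Hk) as (d2 & Hd2 & H2).
  assert (M1 := Rmin_l d1 d2). assert (M2 := Rmin_r d1 d2).
  assert (M3 := Rmin_l 1 (eta / k)). assert (M4 := Rmin_r 1 (eta / k)).
  exists (Rmin d1 d2); split; [apply Rmin_glb_lt; trivial|].
  intros x' z' HS Hx' Hz'.
  assert (F : Rabs (f x' z' - f x z) < Rmin 1 (eta / k)) by (apply H1; trivial; lra).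
  assert (G : Rabs (g x' z' - g x z) < Rmin 1 (eta / k)) by (apply H2; trivial; lra).
  replace (f x' z' * g x' z' - f x z * g x z)
    with ((f x' z' - f x z) * (g x' z' - g x z) + f x z * (g x' z' - g x z)
          + (f x' z' - f x z) * g x z) by ring.
  apply Rle_lt_trans with
    (1 * (eta / k) + Rabs (f x z) * (eta / k) + (eta / k) * Rabs (g x z)).
  - rabs; lra.
  - replace eta with (k * (eta / k)) at 4 by (field; unfold k; lra).
    assert (0 < eta / k) by lra.
    set (q := eta / k) in *; unfold k; nra.
Qed.

Lemma cont2_on_fst (u v f : R -> R) : cont_on_I f -> cont2_on (in_clOmega u v) (fun x _ => f x).
Proof.
  intros Hf x z [Hx _] eta He. destruct (Hf x Hx eta He) as (d & Hd & H).
  exists d; split; trivial. intros x' z' [Hx' _] Hd' _; apply H; trivial.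
Qed.

Lemma cont2_on_snd (S : R -> R -> Prop) : cont2_on S (fun _ z => z).
Proof. intros x z _ eta He; exists eta; split; trivial. Qed.

Lemma cont_on_I_inv (f : R -> R) : cont_on_I f -> (forall x, in_I x -> f x <> 0) ->
  cont_on_I (fun x => / f x).
Proof.
  intros Hf H0 x Hx eta He.
  assert (Hc := clamp_fun_continuity f Hf x).
  assert (Hn : clamp_fun f x <> 0) by (apply H0, clampI_in).
  assert (Hi := continuity_pt_inv _ _ Hc Hn).
  destruct (Hi eta He) as (d & Hd & H).
  exists d; split; [exact Hd|]. intros y Hy Hyd.
  destruct (Req_dec y x) as [->|Hne]; [rewrite Rminus_eq_0, Rabs_R0; trivial|].
  specialize (H y); simpl in H; unfold R_dist, inv_fct, clamp_fun in H.
  rewrite !clampI_id in H by trivial.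
  apply H; repeat split; auto.
Qed.

Lemma cont_on_I_minus (f g : R -> R) : cont_on_I f -> cont_on_I g -> cont_on_I (fun x => f x - g x).
Proof.
  intros Hf Hg x Hx eta He.
  destruct (Hf x Hx (eta / 2)) as (d1 & Hd1 & H1); [lra|].
  destruct (Hg x Hx (eta / 2)) as (d2 & Hd2 & H2); [lra|].
  exists (Rmin d1 d2); split; [apply Rmin_glb_lt; trivial|].
  assert (M1 := Rmin_l d1 d2). assert (M2 := Rmin_r d1 d2).
  intros y Hy Hyd.
  assert (F : Rabs (f y - f x) < eta / 2) by (apply H1; trivial; lra).
  assert (G : Rabs (g y - g x) < eta / 2) by (apply H2; trivial; lra).
  apply Rabs_def2 in F, G; apply Rabs_def1; lra.
Qed.

Lemma psi_cont2 (u v : R -> R) : cont_on_I u -> cont_on_I v ->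
  (forall x, in_I x -> v x < u x) -> cont2_on (in_clOmega u v) (psi u v).
Proof.
  intros Hu Hv Hlt. unfold psi, Rdiv.
  apply cont2_on_mult.
  - intros x z Hxz eta He.
    destruct (cont2_on_lincomb _ _ _ 1 (-1) (cont2_on_snd _) (cont2_on_fst u v v Hv) x z Hxz eta He)
      as (d & Hd & H).
    exists d; split; trivial. intros x' z' H1 H2 H3. specialize (H x' z' H1 H2 H3).
    replace (z' - v x' - (z - v x)) with (1 * z' + -1 * v x' - (1 * z + -1 * v x)) by ring.
    exact H.
  - apply (cont2_on_fst u v (fun x => / (u x - v x))), cont_on_I_inv.
    + apply cont_on_I_minus; trivial.
    + intros x Hx; specialize (Hlt x Hx); lra.
Qed.

Lemma bump_cont2 (u v : R -> R) : cont_on_I u -> cont_on_I v ->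
  cont2_on (in_clOmega u v) (bump u v).
Proof.
  intros Hu Hv. unfold bump.
  apply cont2_on_mult; intros x z Hxz eta He.
  - destruct (cont2_on_lincomb _ _ _ 1 (-1) (cont2_on_snd _) (cont2_on_fst u v v Hv) x z Hxz eta He)
      as (d & Hd & H).
    exists d; split; trivial. intros x' z' H1 H2 H3. specialize (H x' z' H1 H2 H3).
    replace (z' - v x' - (z - v x)) with (1 * z' + -1 * v x' - (1 * z + -1 * v x)) by ring.
    exact H.
  - destruct (cont2_on_lincomb _ _ _ (-1) 1 (cont2_on_snd _) (cont2_on_fst u v u Hu) x z Hxz eta He)
      as (d & Hd & H).
    exists d; split; trivial. intros x' z' H1 H2 H3. specialize (H x' z' H1 H2 H3).
    replace (u x' - z' - (u x - z)) with (-1 * z' + 1 * u x' - (-1 * z + 1 * u x)) by ring.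
    exact H.
Qed.

Lemma bump_derive (u u1 u2 v v1 v2 : R -> R) (x z : R) :
  derivable_pt_lim u x (u1 x) -> derivable_pt_lim u1 x (u2 x) ->
  derivable_pt_lim v x (v1 x) -> derivable_pt_lim v1 x (v2 x) ->
  let bump_x := fun x z => - v1 x * (u x - z) + (z - v x) * u1 x in
  derivable_pt_lim (fun t => bump u v t z) x (bump_x x z) /\
  derivable_pt_lim (fun t => bump u v x t) z (u x + v x - 2 * z) /\
  derivable_pt_lim (fun t => bump_x t z) x
    (- v2 x * (u x - z) - 2 * v1 x * u1 x + (z - v x) * u2 x) /\
  derivable_pt_lim (fun t => u x + v x - 2 * t) z (-2).
Proof.
  intros Hu Hu1 Hv Hv1 bump_x.
  apply is_derive_Reals in Hu, Hu1, Hv, Hv1.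
  repeat split; apply is_derive_Reals; unfold bump, bump_x.
  - auto_derive.
    + repeat split; trivial; [exists (v1 x) | exists (u1 x)]; trivial.
    + change (fun x0 => v x0) with v; change (fun x0 => u x0) with u.
      rewrite (is_derive_unique _ _ _ Hu), (is_derive_unique _ _ _ Hv); ring.
  - auto_derive; trivial; ring.
  - auto_derive.
    + repeat split; trivial; try solve [exists (v1 x); trivial]; try solve [exists (v2 x); trivial];
      try solve [exists (u1 x); trivial]; try solve [exists (u2 x); trivial].
    + change (fun x0 => v x0) with v; change (fun x0 => u x0) with u.
      change (fun x0 => v1 x0) with v1; change (fun x0 => u1 x0) with u1.
      rewrite (is_derive_unique _ _ _ Hu), (is_derive_unique _ _ _ Hv).
      rewrite (is_derive_unique _ _ _ Hu1), (is_derive_unique _ _ _ Hv1); ring.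
  - auto_derive; trivial; ring.
Qed.

Lemma derivable_pt_lim_comb3 (f g h : R -> R) (a b c x f' g' h' : R) :
  derivable_pt_lim f x f' -> derivable_pt_lim g x g' -> derivable_pt_lim h x h' ->
  derivable_pt_lim (fun t => a * (1 * f t + b * g t) + c * h t) x
    (a * (1 * f' + b * g') + c * h').
Proof.
  intros Hf Hg Hh.
  apply is_derive_Reals in Hf, Hg, Hh; apply is_derive_Reals.
  auto_derive.
  - repeat split; [exists f' | exists g' | exists h']; trivial.
  - change (fun x0 => f x0) with f; change (fun x0 => g x0) with g; change (fun x0 => h x0) with h.
    rewrite (is_derive_unique _ _ _ Hf), (is_derive_unique _ _ _ Hg), (is_derive_unique _ _ _ Hh).
    ring.
Qed.

(* [bump] vanishes on the curved boundary while its [z]-derivative of order two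
   is [-2]; this beats the error [e * psi_xx] of the interpolation [psi]. *)
Lemma phi_minus_psi (m e : R) (u u1 u2 v v1 v2 : R -> R) (phi px pz pxx pzz : R -> R -> R) :
  profile m u u1 u2 v v1 v2 -> 0 < e <= 1 / 24 ->
  cont2_on (in_clOmega u v) phi ->
  (forall x z, on_bdry u v x z -> phi x z = psi u v x z) ->
  (forall x z, in_Omega u v x z ->
     derivable_pt_lim (fun t => phi t z) x (px x z) /\
     derivable_pt_lim (fun t => phi x t) z (pz x z) /\
     derivable_pt_lim (fun t => px t z) x (pxx x z) /\
     derivable_pt_lim (fun t => pz x t) z (pzz x z) /\
     e * pxx x z + pzz x z = 0) ->
  forall x z, in_clOmega u v x z ->
    Rabs (phi x z - psi u v x z) <= 118 / m ^ 3 * e * bump u v x z.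
Proof.
  intros Hp He Hphi Hbd HL.
  assert (Hp' := Hp).
  destruct Hp' as (Hm & (Cu & _ & _ & Du) & (Cv & _ & _ & Dv) & Hw & Hb).
  assert (Hlt : forall x, in_I x -> v x < u x) by (intros x Hx; destruct (Hw x Hx); lra).
  assert (Q : 1 <= / m ^ 3).
  { rewrite <- Rinv_1 at 1; apply Rinv_le_contravar; [apply pow_lt; lra|].
    rewrite <- (pow1 3); apply pow_incr; lra. }
  (* The sign [s] treats the upper and the lower bound by the same argument. *)
  assert (Hs : forall s, s = 1 \/ s = -1 -> forall x z, in_clOmega u v x z ->
    s * (1 * phi x z + -1 * psi u v x z) + (- (118 / m ^ 3 * e)) * bump u v x z <= 0).
  { intros s Hs.
    apply (maximum_principle u v e (-1) 0
      (fun x z => s * (1 * phi x z + -1 * psi u v x z) + (- (118 / m ^ 3 * e)) * bump u v x z)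
      (fun x z => s * (1 * px x z + -1 * (- v1 x * / (u x - v x) - (z - v x) * (u1 x - v1 x) * / (u x - v x) ^ 2))
                  + (- (118 / m ^ 3 * e)) * (- v1 x * (u x - z) + (z - v x) * u1 x))
      (fun x z => s * (1 * pz x z + -1 * / (u x - v x)) + (- (118 / m ^ 3 * e)) * (u x + v x - 2 * z))
      (fun x z => s * (1 * pxx x z + -1 * psi_xx u u1 u2 v v1 v2 x z)
                  + (- (118 / m ^ 3 * e)) * (- v2 x * (u x - z) - 2 * v1 x * u1 x + (z - v x) * u2 x))
      (fun x z => s * (1 * pzz x z + -1 * 0) + (- (118 / m ^ 3 * e)) * -2)); trivial.
    - intros x Hx; destruct (Hw x Hx); lra.
    - lra.
    - apply cont2_on_lincomb; [apply cont2_on_lincomb|]; trivial.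
      + apply psi_cont2; trivial.
      + apply bump_cont2; trivial.
    - intros x z Hxz.
      destruct (HL x z Hxz) as (P1 & P2 & P3 & P4 & P5).
      assert (Hxz' := Hxz); destruct Hxz' as [Hx Hz].
      destruct (Du x Hx) as [U1 U2]. destruct (Dv x Hx) as [V1 V2].
      destruct (psi_derive u u1 u2 v v1 v2 x z U1 U2 V1 V2) as (S1 & S2 & S3); [lra|].
      destruct (bump_derive u u1 u2 v v1 v2 x z U1 U2 V1 V2) as (T1 & T2 & T3 & T4).
      repeat split.
      + apply derivable_pt_lim_comb3; trivial.
      + apply derivable_pt_lim_comb3; trivial.
      + apply derivable_pt_lim_comb3; trivial.
      + apply derivable_pt_lim_comb3; trivial. apply derivable_pt_lim_const.
      + assert (Hxx := psi_xx_bound m u u1 u2 v v1 v2 x z Hp Hxz).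
        destruct (Hb x Hx) as (B1 & B2 & B3 & B4).
        destruct (Hw x (in_oI_in_I x Hx)) as (W1 & W2 & W3).
        (* The second [x]-derivative of [bump] is at most [3 + 18 + 3 = 24] in absolute value; this
           is the origin of [e <= 1 / 24], which gives [e * b <= 1] below. *)
        assert (BB : Rabs (- v2 x * (u x - z) - 2 * v1 x * u1 x + (z - v x) * u2 x)
                     <= 3 * 1 + 2 * 3 * 3 + 1 * 3).
        { rabs; trivial; apply Rabs_le; lra. }
        apply Rabs_le_between in Hxx, BB. unfold Rdiv in *.
        set (q := / m ^ 3) in *. set (y := psi_xx _ _ _ _ _ _ _ _) in *.
        set (b := - v2 x * _ - _ + _) in *.
        replace (e * (s * (1 * pxx x z + -1 * y) + - (118 * q * e) * b) +
                 (s * (1 * pzz x z + -1 * 0) + - (118 * q * e) * -2))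
          with (s * (e * pxx x z + pzz x z) + e * (236 * q - s * y - 118 * q * (e * b))) by ring.
        rewrite P5.
        assert (e * b <= 1) by nra.
        assert (s * y <= 117 * q) by (destruct Hs; subst s; lra).
        (* The margin is [236 - 117 - 118 = 1] times [q]: 118 is one more than the constant bounding
           [psi_xx]. *)
        assert (0 < 236 * q - s * y - 118 * q * (e * b)) by nra.
        nra.
    - intros x z Hxz. rewrite (Hbd x z Hxz).
      destruct Hxz as [[Hx Hz] _].
      assert (0 <= bump u v x z) by (apply Rmult_le_pos; lra).
      assert (0 <= 118 / m ^ 3 * e) by (unfold Rdiv; nra).
      nra. }
  intros x z Hxz.
  assert (H1 := Hs 1 (or_introl eq_refl) x z Hxz).
  assert (H2 := Hs (-1) (or_intror eq_refl) x z Hxz).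
  apply Rabs_le; lra.
Qed.

(** * Traces of the gradient on the curved boundary *)

(** A closed bound survives the limit along points of [S] approaching [(x, z)]. This carries
    interior estimates to the curves, where only continuity of the gradient is known. *)
Lemma le_of_nearby (F : R -> R -> R) (S : R -> R -> Prop) (x z l c : R) :
  cont2_on S F -> S x z ->
  (forall d, 0 < d -> exists x' z', S x' z' /\ Rabs (x' - x) < d /\ Rabs (z' - z) < d /\
    Rabs (F x' z' - l) <= c) ->
  Rabs (F x z - l) <= c.
Proof.
  intros HF Hxz H.
  apply Rnot_lt_le; intros Hlt.
  destruct (HF x z Hxz (Rabs (F x z - l) - c)) as (d & Hd & K); [lra|].
  destruct (H d Hd) as (x' & z' & HS & H1 & H2 & H3).
  specialize (K x' z' HS H1 H2).
  assert (T := Rabs_triang (F x z - F x' z') (F x' z' - l)).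
  rewrite (Rabs_minus_sym (F x z)) in T.
  replace (F x z - F x' z' + (F x' z' - l)) with (F x z - l) in T by ring. lra.
Qed.

(* [f] is [1 - phi] on the upper curve; the lower curve is covered by the
   reflection [z -> - z], under which [u], [v], [f] become [- v], [- u], [phi]. *)
Lemma boundary_gradient (m eta x : R) (u v : R -> R) (f fx fz : R -> R -> R) :
  0 < m -> 0 <= eta -> cont_on_I v -> in_oI x ->
  (forall t, in_oI t -> m <= u t - v t) ->
  (forall s t, in_oI s -> in_oI t -> Rabs (u s - u t) <= 3 * Rabs (s - t)) ->
  cont2_on (in_OmegaG u v) fx -> cont2_on (in_OmegaG u v) fz ->
  (forall t z, in_Omega u v t z ->
     derivable_pt_lim (fun s => f s z) t (fx t z) /\
     derivable_pt_lim (fun s => f t s) z (fz t z) /\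
     Rabs (f t z - (u t - z) / (u t - v t)) <= eta * (u t - z)) ->
  Rabs (fz x (u x) + / (u x - v x)) <= 3 * eta /\
  Rabs (fx x (u x)) <= 11 * (/ m + eta).
Proof.
  intros Hm Heta Cv Hx Hw HL Cfx Cfz Hf.
  assert (Hwx := Hw x Hx).
  assert (Hb : in_OmegaG u v x (u x)) by (right; split; [trivial | left; trivial]).
  destruct (cont_on_I_open v x (v x - 1) ((u x + v x) / 2) Cv Hx) as (d0 & Hd0 & Hv0); [lra|].
  split.
  - replace (fz x (u x) + / (u x - v x)) with (fz x (u x) - - / (u x - v x)) by ring.
    apply (le_of_nearby fz (in_OmegaG u v)); trivial.
    intros d Hd.
    (* The mean value theorem is applied between depths [2 * h] and [h] below the curve, so the
       segment stays inside the domain. At its ends [f] deviates from the linear model by at most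
       [2 * eta * h] and [eta * h], hence the quotient by at most [3 * eta]. *)
    set (h := Rmin d (u x - v x) / 4).
    assert (Hh : 0 < h /\ 4 * h <= d /\ 4 * h <= u x - v x).
    { assert (M1 := Rmin_l d (u x - v x)). assert (M2 := Rmin_r d (u x - v x)).
      assert (0 < Rmin d (u x - v x)) by (apply Rmin_glb_lt; lra). unfold h; lra. }
    assert (HO : forall z, u x - 2 * h <= z <= u x - h -> in_Omega u v x z)
      by (intros z Hz; split; [trivial | lra]).
    destruct (MVT_cor2 (fun z => f x z) (fun z => fz x z) (u x - 2 * h) (u x - h)) as (c & Hc & Hcc).
    + lra.
    + intros z Hz; apply Hf, HO, Hz.
    + exists x, c. split; [left; apply HO; lra|].
      split; [rewrite Rminus_eq_0, Rabs_R0; trivial|].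
      split; [apply Rabs_def1; lra|].
      destruct (Hf x (u x - 2 * h)) as (_ & _ & F1); [apply HO; lra|].
      destruct (Hf x (u x - h)) as (_ & _ & F2); [apply HO; lra|].
      replace (u x - h - (u x - 2 * h)) with h in Hc by ring.
      replace (u x - (u x - 2 * h)) with (2 * h) in F1 by ring.
      replace (u x - (u x - h)) with h in F2 by ring.
      unfold Rdiv in F1, F2. set (q := / (u x - v x)) in *.
      apply Rabs_le_between in F1, F2. apply Rabs_le; split; nra.
  - rewrite <- (Rminus_0_r (fx x (u x))).
    apply (le_of_nearby fx (in_OmegaG u v)); trivial.
    intros d Hd.
    (* The horizontal segment has length [h] and starts at depth [4 * h]. As [u] is 3-Lipschitz, the
       depth stays between [h] and [7 * h], so [|f|] at the two ends is at most [4 * h] and [7 * h]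
       times [/ m + eta]; this explains the factor 11. *)
    set (h := Rmin d (Rmin d0 (Rmin m (1 - x))) / 16).
    assert (Hh : 0 < h /\ 16 * h <= d /\ 16 * h <= d0 /\ 16 * h <= m /\ 16 * h <= 1 - x).
    { unfold in_oI in Hx.
      assert (M1 := Rmin_l d (Rmin d0 (Rmin m (1 - x)))). assert (M2 := Rmin_r d (Rmin d0 (Rmin m (1 - x)))).
      assert (M3 := Rmin_l d0 (Rmin m (1 - x))). assert (M4 := Rmin_r d0 (Rmin m (1 - x))).
      assert (M5 := Rmin_l m (1 - x)). assert (M6 := Rmin_r m (1 - x)).
      assert (0 < Rmin d (Rmin d0 (Rmin m (1 - x)))) by (repeat apply Rmin_glb_lt; lra).
      unfold h; lra. }
    assert (HO : forall t, x <= t <= x + h ->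
              in_Omega u v t (u x - 4 * h) /\ h <= u t - (u x - 4 * h) <= 7 * h).
    { intros t Ht.
      assert (Htx : Rabs (t - x) <= h) by (apply Rabs_le; lra).
      destruct (Hv0 t) as [Hto Hvt]; [lra|].
      assert (Hl := HL t x Hto Hx).
      assert (Hl' : Rabs (u t - u x) <= 3 * h) by lra.
      apply Rabs_le_between in Hl'.
      split; [split; [trivial | lra] | lra]. }
    destruct (MVT_cor2 (fun t => f t (u x - 4 * h)) (fun t => fx t (u x - 4 * h)) x (x + h)) as (c & Hc & Hcc).
    + lra.
    + intros t Ht; apply Hf, HO, Ht.
    + exists c, (u x - 4 * h). destruct (HO c) as [Hcin _]; [lra|].
      split; [left; trivial|].
      split; [apply Rabs_def1; lra|]. split; [apply Rabs_def1; lra|].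
      assert (HB : forall t, x <= t <= x + h -> Rabs (f t (u x - 4 * h)) <=
                     (/ m + eta) * (u t - (u x - 4 * h))).
      { intros t Ht. destruct (HO t Ht) as [Hin Hrange].
        destruct (Hf t _ Hin) as (_ & _ & F).
        assert (Hwt := Hw t (proj1 Hin)).
        assert (/ (u t - v t) <= / m) by (apply Rinv_le_contravar; lra).
        assert (0 < / (u t - v t)) by (apply Rinv_0_lt_compat; lra).
        unfold Rdiv in F. set (q := / (u t - v t)) in *.
        apply Rabs_le_between in F. apply Rabs_le; nra. }
      assert (F1 := HB x ltac:(lra)). assert (F2 := HB (x + h) ltac:(lra)).
      destruct (HO (x + h)) as [_ Hr]; [lra|].
      replace (x + h - x) with h in Hc by ring.
      replace (u x - (u x - 4 * h)) with (4 * h) in F1 by ring.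
      assert (0 < / m) by (apply Rinv_0_lt_compat; lra).
      apply Rabs_le_between in F1, F2.
      rewrite Rminus_0_r. set (q := / m) in *.
      assert ((q + eta) * (u (x + h) - (u x - 4 * h)) <= (q + eta) * (7 * h))
        by (apply Rmult_le_compat_l; lra).
      apply Rabs_le; split; nra.
Qed.

Lemma lipschitz_on_oI (f f1 : R -> R) (M : R) :
  (forall x, in_oI x -> derivable_pt_lim f x (f1 x) /\ Rabs (f1 x) <= M) ->
  forall s t, in_oI s -> in_oI t -> Rabs (f s - f t) <= M * Rabs (s - t).
Proof.
  intros H.
  assert (H' : forall s t, in_oI s -> in_oI t -> s < t -> Rabs (f s - f t) <= M * Rabs (s - t)).
  { intros s t Hs Ht Hst.
    destruct (MVT_cor2 f f1 s t Hst) as (c & Hc & Hcc).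
    - intros c Hc; apply H; unfold in_oI in *; lra.
    - rewrite (Rabs_minus_sym (f s)), (Rabs_minus_sym s), Hc, Rabs_mult.
      apply Rmult_le_compat_r; [apply Rabs_pos|]. apply H; unfold in_oI in *; lra. }
  intros s t Hs Ht.
  destruct (Rtotal_order s t) as [L | [-> | G]].
  - apply H'; trivial.
  - rewrite !Rminus_eq_0, Rabs_R0; lra.
  - rewrite (Rabs_minus_sym (f s)), (Rabs_minus_sym s); apply H'; trivial.
Qed.

Lemma derivable_pt_lim_reflect (f : R -> R) (x l : R) :
  derivable_pt_lim f (- x) l -> derivable_pt_lim (fun t => f (- t)) x (- l).
Proof.
  intros H. apply (derivable_pt_lim_eq _ _ _ (l * -1)); [|ring].
  apply (derivable_pt_lim_comp Ropp f); [|trivial].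
  apply derivable_pt_lim_opp, derivable_pt_lim_id.
Qed.

Lemma cont_on_I_opp (f : R -> R) : cont_on_I f -> cont_on_I (fun x => - f x).
Proof.
  intros H x Hx eta He; destruct (H x Hx eta He) as (d & Hd & K).
  exists d; split; trivial. intros y Hy Hyd.
  replace (- f y - - f x) with (- (f y - f x)) by ring. rewrite Rabs_Ropp; auto.
Qed.

Lemma in_OmegaG_reflect (u v : R -> R) (x z : R) :
  in_OmegaG (fun x => - v x) (fun x => - u x) x z -> in_OmegaG u v x (- z).
Proof.
  intros [[Hx Hz] | [Hx [-> | ->]]].
  - left; split; [trivial | lra].
  - right; split; [trivial | right; ring].
  - right; split; [trivial | left; ring].
Qed.

(** The factor [s] is 1 for the [x]-derivative and -1 for the [z]-derivative of the reflected
    function. *)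
Lemma cont2_on_reflect (u v : R -> R) (s : R) (F : R -> R -> R) : s = 1 \/ s = -1 ->
  cont2_on (in_OmegaG u v) F ->
  cont2_on (in_OmegaG (fun x => - v x) (fun x => - u x)) (fun x z => s * F x (- z)).
Proof.
  intros Hs HF x z Hxz eta He.
  destruct (HF _ _ (in_OmegaG_reflect u v x z Hxz) eta He) as (d & Hd & H).
  exists d; split; trivial. intros x' z' H1 H2 H3.
  rewrite <- Rmult_minus_distr_l, Rabs_mult.
  replace (Rabs s) with 1
    by (destruct Hs; subst s; [rewrite Rabs_pos_eq | rewrite Rabs_left]; lra).
  rewrite Rmult_1_l. apply H; trivial.
  - apply in_OmegaG_reflect; trivial.
  - replace (- z' - - z) with (- (z' - z)) by ring. rewrite Rabs_Ropp; trivial.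
Qed.

(** Since [eta <= / m], the tangential bound becomes [22 * / m], whose square gives 484. The
    difference of squares factors as [(pz - q) * (pz - q + 2 * q)], which is at most [3 * eta] times
    [3 * / m]. *)
Lemma gradient_square_near (a e eta q m px pz : R) :
  0 < m <= 1 -> 0 <= e -> 0 <= eta -> 3 * eta <= / m -> 0 < q <= / m -> 0 < a ->
  Rabs (px) <= 11 * (/ m + eta) -> Rabs (pz - q) <= 3 * eta ->
  Rabs (a * (e * px ^ 2 + pz ^ 2) - a * q ^ 2) <= a * (484 * e * (/ m) ^ 2 + 9 * eta * / m).
Proof.
  intros Hm He Heta H3 Hq Ha Hx Hz.
  replace (a * (e * px ^ 2 + pz ^ 2) - a * q ^ 2)
    with (a * (e * px ^ 2 + (pz - q) * ((pz - q) + 2 * q))) by ring.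
  rewrite Rabs_mult, (Rabs_pos_eq a) by lra.
  apply Rmult_le_compat_l; [lra|].
  assert (X2 : px ^ 2 <= (22 * / m) ^ 2).
  { rewrite <- (pow2_abs px). apply pow_incr; split; [apply Rabs_pos | lra]. }
  assert (P : 0 <= px ^ 2) by apply pow2_ge_0.
  assert (Z : Rabs ((pz - q) * ((pz - q) + 2 * q)) <= 3 * eta * (/ m + 2 * / m)).
  { apply Rabs_mult_le; trivial. apply Rabs_plus_le; [lra|]. rewrite Rabs_pos_eq; lra. }
  apply Rle_trans with (e * (22 * / m) ^ 2 + 3 * eta * (/ m + 2 * / m)); [|right; ring].
  apply Rabs_plus_le; trivial.
  rewrite Rabs_pos_eq; [apply Rmult_le_compat_l | apply Rmult_le_pos]; lra.
Qed.

(** Here [e] stands for [eps ^ 2]. On both curves [pz] differs from the slope [/ (u - v)] of [psi]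
    by a multiple of [e], while [px] is only bounded but enters the law with the factor [e]. *)
Lemma curvature_near (m e lam mu : R) (u u1 u2 v v1 v2 : R -> R) (phi px pz pxx pzz : R -> R -> R) :
  profile m u u1 u2 v v1 v2 -> 0 < lam -> 0 < mu -> 0 < e <= 1 / 24 -> 354 * e <= m ^ 2 ->
  cont2_on (in_clOmega u v) phi ->
  (forall x z, on_bdry u v x z -> phi x z = psi u v x z) ->
  (forall x z, in_Omega u v x z ->
     derivable_pt_lim (fun t => phi t z) x (px x z) /\
     derivable_pt_lim (fun t => phi x t) z (pz x z) /\
     derivable_pt_lim (fun t => px t z) x (pxx x z) /\
     derivable_pt_lim (fun t => pz x t) z (pzz x z) /\
     e * pxx x z + pzz x z = 0) ->
  cont2_on (in_OmegaG u v) px -> cont2_on (in_OmegaG u v) pz ->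
  (forall x, in_oI x -> u2 x = lam * (e * (px x (u x)) ^ 2 + (pz x (u x)) ^ 2)) ->
  (forall x, in_oI x -> v2 x = - mu * (e * (px x (v x)) ^ 2 + (pz x (v x)) ^ 2)) ->
  forall x, in_oI x ->
    Rabs (u2 x - lam * (/ (u x - v x)) ^ 2) <= lam * (1546 / m ^ 4) * e /\
    Rabs (v2 x + mu * (/ (u x - v x)) ^ 2) <= mu * (1546 / m ^ 4) * e.
Proof.
  intros Hp Hlam Hmu He Hem Cphi Hbd HL Cpx Cpz Hu2 Hv2 x Hx.
  assert (Hcl := phi_minus_psi m e u u1 u2 v v1 v2 phi px pz pxx pzz Hp He Cphi Hbd HL).
  destruct Hp as (Hm & (Cu & _ & _ & Du) & (Cv & _ & _ & Dv) & Hw & Hb).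
  set (eta := 118 / m ^ 3 * e) in *.
  assert (P3 : 0 < m ^ 3) by (apply pow_lt; lra).
  assert (Hie : 0 < / m ^ 3) by (apply Rinv_0_lt_compat; trivial).
  assert (Heta : 0 <= eta) by (unfold eta, Rdiv; nra).
  (* Multiplied by [m ^ 3] this is the assumption on [e], with [354 = 3 * 118]. *)
  assert (Heta3 : 3 * eta <= / m).
  { unfold eta. apply Rmult_le_reg_l with (m ^ 3); trivial.
    replace (m ^ 3 * (3 * (118 / m ^ 3 * e))) with (354 * e) by (field; lra).
    replace (m ^ 3 * / m) with (m ^ 2) by (field; lra). trivial. }
  assert (Hgap : forall t, in_oI t -> m <= u t - v t)
    by (intros t Ht; apply Hw, in_oI_in_I, Ht).
  assert (Hwx := Hgap x Hx).
  assert (Hq : 0 < / (u x - v x) <= / m)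
    by (split; [apply Rinv_0_lt_compat | apply Rinv_le_contravar]; lra).
  assert (Hin : forall t z, in_Omega u v t z -> in_clOmega u v t z)
    by (intros t z [Ht Hz]; split; [apply in_oI_in_I, Ht | lra]).
  (* [1546 = 484 + 9 * 118], the square of [/ m] being absorbed by its fourth power. *)
  assert (Hend : 484 * e * (/ m) ^ 2 + 9 * eta * / m <= 1546 / m ^ 4 * e).
  { unfold eta, Rdiv. rewrite <- !pow_inv.
    assert (Q1 : 1 <= / m) by (rewrite <- Rinv_1 at 1; apply Rinv_le_contravar; lra).
    assert ((/ m) ^ 2 <= (/ m) ^ 4) by (apply Rle_pow; [trivial | lia]).
    nra. }
  destruct (boundary_gradient m eta x u v (fun t z => 1 - phi t z)
     (fun t z => - px t z) (fun t z => - pz t z)) as [Gz Gx]; trivial.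
  { lra. }
  { apply (lipschitz_on_oI u u1). intros t Ht; split; [apply Du, Ht | apply Hb, Ht]. }
  { intros t z Htz eps0 He0; destruct (Cpx t z Htz eps0 He0) as (d & Hd & K).
    exists d; split; trivial. intros; rewrite <- Rabs_Ropp.
    replace (- (- px x' z' - - px t z)) with (px x' z' - px t z) by ring; auto. }
  { intros t z Htz eps0 He0; destruct (Cpz t z Htz eps0 He0) as (d & Hd & K).
    exists d; split; trivial. intros; rewrite <- Rabs_Ropp.
    replace (- (- pz x' z' - - pz t z)) with (pz x' z' - pz t z) by ring; auto. }
  { intros t z Htz. destruct (HL t z Htz) as (D1 & D2 & _).
    split; [|split].
    - apply (derivable_pt_lim_eq _ _ _ (0 - px t z)); [|ring].
      apply (derivable_pt_lim_minus (fun _ => 1)); [apply derivable_pt_lim_const | trivial].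
    - apply (derivable_pt_lim_eq _ _ _ (0 - pz t z)); [|ring].
      apply (derivable_pt_lim_minus (fun _ => 1)); [apply derivable_pt_lim_const | trivial].
    - assert (F := Hcl t z (Hin t z Htz)). destruct Htz as [Ht Hz].
      assert (Hwt := Hgap t Ht). destruct (Hw t (in_oI_in_I t Ht)) as (W1 & W2 & _).
      replace (1 - phi t z - (u t - z) / (u t - v t)) with (- (phi t z - psi u v t z))
        by (unfold psi; field; lra).
      (* The factor [z - v] of the barrier is at most 1, which leaves the distance [u - z] to the
         upper curve. *)
      rewrite Rabs_Ropp. apply Rle_trans with (1 := F). unfold bump.
      apply Rmult_le_compat_l; trivial. nra. }
  destruct (boundary_gradient m eta x (fun x => - v x) (fun x => - u x) (fun t z => phi t (- z))
     (fun t z => 1 * px t (- z)) (fun t z => -1 * pz t (- z))) as [Gz' Gx']; trivial.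
  { lra. }
  { apply cont_on_I_opp, Cu. }
  { intros t Ht; specialize (Hgap t Ht); lra. }
  { intros s t Hs Ht. replace (- v s - - v t) with (- (v s - v t)) by ring. rewrite Rabs_Ropp.
    apply (lipschitz_on_oI v v1); trivial.
    intros r Hr; split; [apply Dv, Hr | apply Hb, Hr]. }
  { apply cont2_on_reflect; auto. }
  { apply cont2_on_reflect; auto. }
  { intros t z [Ht Hz].
    assert (Htz : in_Omega u v t (- z)) by (split; [trivial | lra]).
    destruct (HL t (- z) Htz) as (D1 & D2 & _).
    split; [|split].
    - rewrite Rmult_1_l; trivial.
    - apply (derivable_pt_lim_eq _ _ _ (- pz t (- z))); [|ring].
      apply (derivable_pt_lim_reflect (fun s => phi t s)); trivial.
    - assert (F := Hcl t (- z) (Hin t (- z) Htz)).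
      assert (Hwt := Hgap t Ht). destruct (Hw t (in_oI_in_I t Ht)) as (W1 & W2 & _).
      replace (phi t (- z) - (- v t - z) / (- v t - - u t)) with (phi t (- z) - psi u v t (- z))
        by (unfold psi; field; lra).
      apply Rle_trans with (1 := F). unfold bump.
      apply Rmult_le_compat_l; trivial. nra. }
  rewrite Rabs_Ropp in Gx.
  replace (- pz x (u x) + / (u x - v x)) with (- (pz x (u x) - / (u x - v x))) in Gz by ring.
  rewrite Rabs_Ropp in Gz.
  rewrite Ropp_involutive, Rmult_1_l in Gx'.
  replace (-1 * pz x (- - v x) + / (- v x - - u x)) with (- (pz x (v x) - / (u x - v x))) in Gz'
    by (rewrite Ropp_involutive; replace (- v x - - u x) with (u x - v x) by ring; ring).
  rewrite Rabs_Ropp in Gz'.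
  rewrite !(Rmult_assoc _ (1546 / m ^ 4)).
  split.
  - rewrite (Hu2 x Hx).
    apply Rle_trans with (lam * (484 * e * (/ m) ^ 2 + 9 * eta * / m));
      [apply gradient_square_near; trivial; lra | apply Rmult_le_compat_l; lra].
  - rewrite (Hv2 x Hx).
    replace (- mu * (e * px x (v x) ^ 2 + pz x (v x) ^ 2) + mu * (/ (u x - v x)) ^ 2)
      with (- (mu * (e * px x (v x) ^ 2 + pz x (v x) ^ 2) - mu * (/ (u x - v x)) ^ 2)) by ring.
    rewrite Rabs_Ropp.
    apply Rle_trans with (mu * (484 * e * (/ m) ^ 2 + 9 * eta * / m));
      [apply gradient_square_near; trivial; lra | apply Rmult_le_compat_l; lra].
Qed.

(** * Stability of the limiting equations *)

Lemma exp_monotone (x y : R) : x <= y -> exp x <= exp y.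
Proof. intros [H | ->]; [left; apply exp_increasing, H | right; trivial]. Qed.

(** The product [(E + eta) * exp (- M * t)] has nonpositive derivative; [exp M] then dominates
    [exp (M * x)] because [x < 1]. *)
Lemma gronwall_right (E E1 : R -> R) (M eta x : R) :
  0 <= M -> 0 <= x < 1 ->
  (forall t, in_oI t -> derivable_pt_lim E t (E1 t) /\ E1 t <= M * (E t + eta) /\ 0 <= E t + eta) ->
  E x + eta <= (E 0 + eta) * exp M.
Proof.
  intros HM Hx H.
  assert (H0 : 0 <= E 0 + eta) by (apply H; unfold in_oI; lra).
  destruct (Req_dec x 0) as [->|Hx0].
  { assert (1 <= exp M) by (rewrite <- exp_0; apply exp_monotone; trivial). nra. }
  destruct (MVT_cor2 (fun t => (E t + eta) * exp (- M * t))
    (fun t => (E1 t - M * (E t + eta)) * exp (- M * t)) 0 x) as (c & Hc & Hcc); [lra| |].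
  - intros t Ht. destruct (H t) as (Hd & _); [unfold in_oI; lra|].
    apply is_derive_Reals in Hd. apply is_derive_Reals. auto_derive.
    + exists (E1 t); trivial.
    + change (fun x0 => E x0) with E. rewrite (is_derive_unique _ _ _ Hd). ring.
  - destruct (H c) as (_ & Hle & _); [unfold in_oI; lra|].
    assert (G : (E x + eta) * exp (- M * x) <= E 0 + eta).
    { assert (X := exp_pos (- M * c)).
      assert (K : (E1 c - M * (E c + eta)) * exp (- M * c) * (x - 0) <= 0).
      { assert ((E1 c - M * (E c + eta)) * exp (- M * c) <= 0) by nra. nra. }
      rewrite Rmult_0_r, exp_0, Rmult_1_r in Hc. lra. }
    assert (Hx' : 0 <= E x + eta) by (apply H; unfold in_oI; lra).
    assert (Y : exp (- M * x) * exp (M * x) = 1)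
      by (rewrite <- exp_plus, <- exp_0; f_equal; ring).
    apply Rle_trans with ((E 0 + eta) * exp (M * x)).
    + replace (E x + eta) with ((E x + eta) * exp (- M * x) * exp (M * x))
        by (rewrite Rmult_assoc, Y; ring).
      apply Rmult_le_compat_r; [left; apply exp_pos | trivial].
    + apply Rmult_le_compat_l; trivial. apply exp_monotone; nra.
Qed.

(** The left half is the right half for the reflected function, which is why the bound concerns
    [Rabs (E1 t)]. *)
Lemma gronwall (E E1 : R -> R) (M eta x : R) :
  0 <= M -> in_oI x ->
  (forall t, in_oI t -> derivable_pt_lim E t (E1 t) /\ Rabs (E1 t) <= M * (E t + eta) /\ 0 <= E t + eta) ->
  E x + eta <= (E 0 + eta) * exp M.
Proof.
  intros HM Hx H. unfold in_oI in Hx.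
  destruct (Rle_dec 0 x) as [Hp|Hn].
  - apply (gronwall_right E E1); trivial; [lra|].
    intros t Ht; destruct (H t Ht) as (A1 & A2 & A3); repeat split; trivial.
    apply Rle_trans with (1 := Rle_abs _) (2 := A2).
  - assert (G := gronwall_right (fun t => E (- t)) (fun t => - E1 (- t)) M eta (- x) HM).
    cbv beta in G; rewrite Ropp_involutive, Ropp_0 in G. apply G; [lra|].
    intros t Ht; destruct (H (- t)) as (A1 & A2 & A3); [unfold in_oI in *; lra|].
    repeat split; trivial.
    + apply derivable_pt_lim_reflect; trivial.
    + apply Rle_trans with (2 := A2). rewrite <- Rabs_Ropp. apply Rle_abs.
Qed.

(** The limit system up to a defect [delta]. The vanishing slopes at 0 turn it into an initial value
    problem in which only the two values at 0 remain free. *)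
Definition near_solution (m lam mu delta : R) (u u1 u2 v v1 v2 : R -> R) : Prop :=
  profile m u u1 u2 v v1 v2 /\
  u (-1) = 0 /\ u 1 = 0 /\ v (-1) = -1 /\ v 1 = -1 /\ u1 0 = 0 /\ v1 0 = 0 /\
  forall x, in_oI x ->
    Rabs (u2 x - lam * (/ (u x - v x)) ^ 2) <= delta /\
    Rabs (v2 x + mu * (/ (u x - v x)) ^ 2) <= delta.

Lemma inv_square_lipschitz (m w w' : R) : 0 < m -> m <= w -> m <= w' ->
  Rabs ((/ w) ^ 2 - (/ w') ^ 2) <= 2 / m ^ 3 * Rabs (w - w').
Proof.
  intros Hm H H'.
  assert (A : 0 < / w <= / m) by (split; [apply Rinv_0_lt_compat | apply Rinv_le_contravar]; lra).
  assert (A' : 0 < / w' <= / m) by (split; [apply Rinv_0_lt_compat | apply Rinv_le_contravar]; lra).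
  replace ((/ w) ^ 2 - (/ w') ^ 2) with ((/ w * / w' * (/ w + / w')) * - (w - w')) by (field; lra).
  rewrite Rabs_mult, Rabs_Ropp. apply Rmult_le_compat_r; [apply Rabs_pos|].
  replace (2 / m ^ 3) with (/ m * / m * (/ m + / m)) by (field; lra).
  set (q := / w) in *. set (q' := / w') in *. set (Q := / m) in *.
  rewrite Rabs_pos_eq by (apply Rmult_le_pos; [apply Rmult_le_pos|]; lra).
  apply Rmult_le_compat; try lra; [apply Rmult_le_pos; lra|].
  apply Rmult_le_compat; lra.
Qed.

Lemma curvature_lipschitz (m lam delta w w' y y' a b : R) :
  0 < m -> 0 < lam -> m <= w -> m <= w' -> Rabs (w - w') <= a + b ->
  Rabs (y - lam * (/ w) ^ 2) <= delta -> Rabs (y' - lam * (/ w') ^ 2) <= delta ->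
  Rabs (y - y') <= lam * (2 / m ^ 3) * (a + b) + 2 * delta.
Proof.
  intros Hm Hlam H H' Hab Hy Hy'.
  assert (L := inv_square_lipschitz m w w' Hm H H').
  assert (P : 0 < 2 / m ^ 3) by (apply Rdiv_lt_0_compat; [lra | apply pow_lt; trivial]).
  set (k := 2 / m ^ 3) in *.
  assert (L2 : Rabs (lam * ((/ w) ^ 2 - (/ w') ^ 2)) <= lam * (k * (a + b))).
  { rewrite Rabs_mult, (Rabs_pos_eq lam) by lra. apply Rmult_le_compat_l; [lra|].
    apply Rle_trans with (1 := L). apply Rmult_le_compat_l; lra. }
  apply Rabs_le_between in L2, Hy, Hy'. apply Rabs_le; lra.
Qed.

(** Young's inequality on each product: the mixed terms [a * a1] and [b * b1] contribute 1 to the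
    factor, the defect contributes 2 more on [a1 ^ 2] and [b1 ^ 2] together with [4 * delta ^ 2],
    and the Lipschitz part contributes [2 * L]. The term [4 * delta ^ 2] will be the shift [eta] of
    the Gronwall lemma. *)
Lemma energy_derivative_bound (L delta a b a1 b1 a2 b2 : R) :
  0 <= L -> 0 <= delta ->
  Rabs a2 <= L * (Rabs a + Rabs b) + 2 * delta ->
  Rabs b2 <= L * (Rabs a + Rabs b) + 2 * delta ->
  Rabs (2 * (a * a1 + b * b1 + a1 * a2 + b1 * b2)) <=
    (3 + 2 * L) * (a ^ 2 + b ^ 2 + a1 ^ 2 + b1 ^ 2 + 4 * delta ^ 2).
Proof.
  intros HL Hd Ha Hb.
  rewrite <- (pow2_abs a), <- (pow2_abs b), <- (pow2_abs a1), <- (pow2_abs b1).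
  apply Rle_trans with (2 * (Rabs a * Rabs a1 + Rabs b * Rabs b1
     + Rabs a1 * (L * (Rabs a + Rabs b) + 2 * delta) + Rabs b1 * (L * (Rabs a + Rabs b) + 2 * delta))).
  - rewrite Rabs_mult, (Rabs_pos_eq 2) by lra. apply Rmult_le_compat_l; [lra|].
    rabs; lra.
  - assert (Ka := Rabs_pos a). assert (Kb := Rabs_pos b).
    assert (Ka1 := Rabs_pos a1). assert (Kb1 := Rabs_pos b1).
    set (A := Rabs a) in *. set (B := Rabs b) in *. set (A1 := Rabs a1) in *. set (B1 := Rabs b1) in *.
    assert (X : (A1 + B1) * (A + B) <= A ^ 2 + B ^ 2 + A1 ^ 2 + B1 ^ 2).
    { assert (0 <= (A1 - A) ^ 2) by apply pow2_ge_0. assert (0 <= (A1 - B) ^ 2) by apply pow2_ge_0.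
      assert (0 <= (B1 - A) ^ 2) by apply pow2_ge_0. assert (0 <= (B1 - B) ^ 2) by apply pow2_ge_0.
      nra. }
    assert (Y1 : 0 <= (A - A1) ^ 2) by apply pow2_ge_0.
    assert (Y2 : 0 <= (B - B1) ^ 2) by apply pow2_ge_0.
    assert (Y3 : 0 <= (delta - A1) ^ 2) by apply pow2_ge_0.
    assert (Y4 : 0 <= (delta - B1) ^ 2) by apply pow2_ge_0.
    assert (Y5 : 0 <= delta ^ 2) by apply pow2_ge_0.
    assert (Z : L * ((A1 + B1) * (A + B)) <= L * (A ^ 2 + B ^ 2 + A1 ^ 2 + B1 ^ 2))
      by (apply Rmult_le_compat_l; trivial).
    assert (Z' : 0 <= L * delta ^ 2) by (apply Rmult_le_pos; trivial).
    nra.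
Qed.

(** Gronwall for the squared distance of values and slopes. All slopes vanish at 0, so the initial
    energy contains only the differences of the values there. *)
Lemma near_solution_stability (m lam mu delta : R) (u u1 u2 v v1 v2 u' u1' u2' v' v1' v2' : R -> R) :
  0 < lam -> 0 < mu -> 0 <= delta ->
  near_solution m lam mu delta u u1 u2 v v1 v2 ->
  near_solution m lam mu delta u' u1' u2' v' v1' v2' ->
  forall x, in_oI x ->
    (u x - u' x) ^ 2 + (v x - v' x) ^ 2 + (u1 x - u1' x) ^ 2 + (v1 x - v1' x) ^ 2 <=
    ((u 0 - u' 0) ^ 2 + (v 0 - v' 0) ^ 2 + 4 * delta ^ 2) * exp (3 + 2 * ((lam + mu) * (2 / m ^ 3))).
Proof.
  intros Hlam Hmu Hdelta (Hp & _ & _ & _ & _ & I1 & I2 & H) (Hp' & _ & _ & _ & _ & I1' & I2' & H') x Hx.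
  destruct Hp as (Hm & (_ & _ & _ & Du) & (_ & _ & _ & Dv) & Hw & _).
  destruct Hp' as (_ & (_ & _ & _ & Du') & (_ & _ & _ & Dv') & Hw' & _).
  assert (P : 0 < 2 / m ^ 3) by (apply Rdiv_lt_0_compat; [lra | apply pow_lt; lra]).
  set (L := (lam + mu) * (2 / m ^ 3)) in *.
  assert (HL : 0 <= L) by (apply Rmult_le_pos; lra).
  assert (G := gronwall
    (fun x => (u x - u' x) ^ 2 + (v x - v' x) ^ 2 + (u1 x - u1' x) ^ 2 + (v1 x - v1' x) ^ 2)
    (fun x => 2 * ((u x - u' x) * (u1 x - u1' x) + (v x - v' x) * (v1 x - v1' x)
       + (u1 x - u1' x) * (u2 x - u2' x) + (v1 x - v1' x) * (v2 x - v2' x)))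
    (3 + 2 * L) (4 * delta ^ 2) x).
  cbv beta in G. rewrite I1, I2, I1', I2' in G.
  assert (D0 : 0 <= delta ^ 2) by apply pow2_ge_0.
  apply Rle_trans with ((u x - u' x) ^ 2 + (v x - v' x) ^ 2 + (u1 x - u1' x) ^ 2 + (v1 x - v1' x) ^ 2 + 4 * delta ^ 2); [lra|].
  replace ((u 0 - u' 0) ^ 2 + (v 0 - v' 0) ^ 2 + 4 * delta ^ 2)
    with ((u 0 - u' 0) ^ 2 + (v 0 - v' 0) ^ 2 + (0 - 0) ^ 2 + (0 - 0) ^ 2 + 4 * delta ^ 2) by ring.
  apply G; [lra | trivial |].
  intros t Ht.
  destruct (Du t Ht) as [U1 U2]. destruct (Dv t Ht) as [V1 V2].
  destruct (Du' t Ht) as [U1' U2']. destruct (Dv' t Ht) as [V1' V2'].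
  assert (W := Hw t (in_oI_in_I t Ht)). assert (W' := Hw' t (in_oI_in_I t Ht)).
  destruct (H t Ht) as [C1 C2]. destruct (H' t Ht) as [C1' C2'].
  assert (S1 : forall s r : R -> R, forall s1 r1, derivable_pt_lim s t s1 -> derivable_pt_lim r t r1 ->
    derivable_pt_lim (fun x => (s x - r x) ^ 2) t (2 * (s t - r t) * (s1 - r1))).
  { intros s r s1 r1 Hs Hr. apply is_derive_Reals in Hs, Hr. apply is_derive_Reals. auto_derive.
    - repeat split; [exists s1 | exists r1]; trivial.
    - change (fun x0 => s x0) with s. change (fun x0 => r x0) with r.
      rewrite (is_derive_unique _ _ _ Hs), (is_derive_unique _ _ _ Hr). ring. }
  repeat split.
  - assert (T := derivable_pt_lim_plus _ _ t _ _ (derivable_pt_lim_plus _ _ t _ _ (derivable_pt_lim_plus _ _ t _ _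
      (S1 _ _ _ _ U1 U1') (S1 _ _ _ _ V1 V1')) (S1 _ _ _ _ U2 U2')) (S1 _ _ _ _ V2 V2')).
    unfold plus_fct in T. eapply derivable_pt_lim_eq; [exact T|]. ring.
  - assert (HW : Rabs (u t - v t - (u' t - v' t)) <= Rabs (u t - u' t) + Rabs (v t - v' t)).
    { replace (u t - v t - (u' t - v' t)) with ((u t - u' t) - (v t - v' t)) by ring.
      apply Rabs_minus_le; lra. }
    assert (K0 : 0 <= Rabs (u t - u' t) + Rabs (v t - v' t))
      by (apply Rplus_le_le_0_compat; apply Rabs_pos).
    apply energy_derivative_bound; trivial.
    + apply Rle_trans with (lam * (2 / m ^ 3) * (Rabs (u t - u' t) + Rabs (v t - v' t)) + 2 * delta).
      * eapply curvature_lipschitz with (w := u t - v t) (w' := u' t - v' t); trivial; lra.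
      * apply Rplus_le_compat_r, Rmult_le_compat_r; trivial. apply Rmult_le_compat_r; lra.
    + apply Rle_trans with (mu * (2 / m ^ 3) * (Rabs (u t - u' t) + Rabs (v t - v' t)) + 2 * delta).
      (* After a change of sign of the second derivative, the equation for [v] has the form of the
         one for [u], with [mu] in place of [lam]. *)
      * replace (v2 t - v2' t) with (- ((- v2 t) - (- v2' t))) by ring. rewrite Rabs_Ropp.
        eapply curvature_lipschitz with (w := u t - v t) (w' := u' t - v' t); trivial; try lra.
        -- rewrite <- Rabs_Ropp. replace (- (- v2 t - mu * (/ (u t - v t)) ^ 2)) with (v2 t + mu * (/ (u t - v t)) ^ 2) by ring. trivial.
        -- rewrite <- Rabs_Ropp. replace (- (- v2' t - mu * (/ (u' t - v' t)) ^ 2)) with (v2' t + mu * (/ (u' t - v' t)) ^ 2) by ring. trivial.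
      * apply Rplus_le_compat_r, Rmult_le_compat_r; trivial. apply Rmult_le_compat_r; lra.
  - assert (Q := pow2_ge_0).
    assert (Q1 := Q (u t - u' t)). assert (Q2 := Q (v t - v' t)).
    assert (Q3 := Q (u1 t - u1' t)). assert (Q4 := Q (v1 t - v1' t)). lra.
Qed.

(** * Passage to the limit *)

Definition unif_cv (S : R -> Prop) (f : nat -> R -> R) (g : R -> R) : Prop :=
  forall eta, 0 < eta -> exists N, forall k, (N <= k)%nat -> forall x, S x -> Rabs (f k x - g x) <= eta.

Lemma Un_cv_le (f : nat -> R) (l c : R) : Un_cv f l -> (exists N, forall k, (N <= k)%nat -> f k <= c) -> l <= c.
Proof.
  intros Hf [N HN]. apply Rnot_lt_le; intros Hlt.
  destruct (Hf (l - c)) as [N' HN']; [lra|].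
  specialize (HN (max N N') ltac:(lia)). specialize (HN' (max N N') ltac:(lia)).
  apply Rabs_def2 in HN'. lra.
Qed.

Lemma unif_cv_Un_cv (S : R -> Prop) (f : nat -> R -> R) (g : R -> R) (x : R) :
  unif_cv S f g -> S x -> Un_cv (fun k => f k x) (g x).
Proof.
  intros H Hx eta He. destruct (H (eta / 2)) as [N HN]; [lra|].
  exists N; intros k Hk. specialize (HN k Hk x Hx). unfold R_dist; lra.
Qed.

Lemma unif_cv_cauchy (S : R -> Prop) (f : nat -> R -> R) :
  (forall eta, 0 < eta -> exists N, forall k l, (N <= k)%nat -> (N <= l)%nat ->
     forall x, S x -> Rabs (f k x - f l x) <= eta) ->
  exists g, unif_cv S f g.
Proof.
  intros H.
  assert (Hl : forall x, exists l, S x -> Un_cv (fun k => f k x) l).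
  (* Outside [S] the value 0 is a default, so that the choice of limits yields a function on all of
     [R]. *)
  { intros x. destruct (classic (S x)) as [Hx|Hx]; [|exists 0; tauto].
    destruct (Rcomplete.R_complete (fun k => f k x)) as [l Hl]; [|exists l; trivial].
    intros eta He. destruct (H (eta / 2)) as [N HN]; [lra|].
    exists N; intros k l Hk Hl. specialize (HN k l Hk Hl x Hx). unfold R_dist; lra. }
  destruct (functional_choice _ Hl) as [g Hg].
  exists g; intros eta He. destruct (H eta He) as [N HN].
  exists N; intros k Hk x Hx.
  (* Starting the second index at [N] makes the Cauchy bound hold for every term, so it passes to
     the limit. *)
  apply Rle_cv_lim with (Un := fun l => Rabs (f k x - f (N + l)%nat x)) (Vn := fun _ => eta).
  - intros l; apply HN; trivial; lia.
  - apply cv_cvabs. apply CV_minus.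
    + intros e0 He0; exists 0%nat; intros. unfold R_dist; rewrite Rminus_eq_0, Rabs_R0; trivial.
    + intros e0 He0. destruct (Hg x Hx e0 He0) as [N' HN']. exists N'; intros n Hn.
      apply HN'; lia.
  - intros e0 He0; exists 0%nat; intros. unfold R_dist; rewrite Rminus_eq_0, Rabs_R0; trivial.
Qed.

Lemma unif_cv_cont_on_I (f : nat -> R -> R) (g : R -> R) :
  (forall k, cont_on_I (f k)) -> unif_cv in_I f g -> cont_on_I g.
Proof.
  intros Hf H x Hx eta He.
  destruct (H (eta / 4)) as [N HN]; [lra|].
  destruct (Hf N x Hx (eta / 4)) as (d & Hd & K); [lra|].
  exists d; split; trivial; intros y Hy Hyd.
  assert (A := HN N (le_n N) x Hx). assert (B := HN N (le_n N) y Hy). assert (C := K y Hy Hyd).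
  apply Rabs_def2 in C. apply Rabs_le_between in A, B. apply Rabs_def1; lra.
Qed.

Lemma unif_cv_CVU (f : nat -> R -> R) (g : R -> R) :
  unif_cv in_oI f g -> CVU f g 0 (mkposreal 1 Rlt_0_1).
Proof.
  intros H eta He. destruct (H (eta / 2)) as [N HN]; [lra|].
  exists N; intros k y Hk Hy. unfold Boule in Hy; simpl in Hy. apply Rabs_def2 in Hy.
  rewrite Rabs_minus_sym. assert (in_oI y) by (unfold in_oI; lra).
  specialize (HN k Hk y H0). lra.
Qed.

Lemma in_oI_Boule (x : R) : in_oI x <-> Boule 0 (mkposreal 1 Rlt_0_1) x.
Proof.
  unfold Boule, in_oI; simpl; rewrite Rminus_0_r; split; intros Hx.
  - apply Rabs_def1; lra.
  - apply Rabs_def2 in Hx; lra.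
Qed.

Lemma unif_cv_continuity (f f1 : nat -> R -> R) (g : R -> R) :
  (forall k x, in_oI x -> derivable_pt_lim (f k) x (f1 k x)) -> unif_cv in_oI f g ->
  forall x, in_oI x -> continuity_pt g x.
Proof.
  intros Hf Hg x Hx.
  apply (CVU_continuity f g 0 (mkposreal 1 Rlt_0_1)).
  - apply unif_cv_CVU, Hg.
  - intros n y Hy. apply derivable_continuous_pt. exists (f1 n y). apply Hf, (proj2 (in_oI_Boule _)), Hy.
  - apply (proj1 (in_oI_Boule _)), Hx.
Qed.

Lemma unif_cv_derivable (f f1 : nat -> R -> R) (g g1 : R -> R) :
  (forall k x, in_oI x -> derivable_pt_lim (f k) x (f1 k x)) ->
  unif_cv in_oI f g -> unif_cv in_oI f1 g1 -> (forall x, in_oI x -> continuity_pt g1 x) ->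
  forall x, in_oI x -> derivable_pt_lim g x (g1 x).
Proof.
  intros Hf Hg Hg1 Hc x Hx.
  apply (derivable_pt_lim_CVU f f1 g g1 x 0 (mkposreal 1 Rlt_0_1)).
  - apply (proj1 (in_oI_Boule _)), Hx.
  - intros y n Hy; apply Hf, (proj2 (in_oI_Boule _)), Hy.
  - intros y Hy; apply (unif_cv_Un_cv in_oI); trivial; apply (proj2 (in_oI_Boule _)), Hy.
  - apply unif_cv_CVU, Hg1.
  - intros y Hy; apply Hc, (proj2 (in_oI_Boule _)), Hy.
Qed.

Lemma unif_cv_abs_le (S : R -> Prop) (f : nat -> R -> R) (g : R -> R) (M x : R) :
  unif_cv S f g -> S x -> (forall k, Rabs (f k x) <= M) -> Rabs (g x) <= M.
Proof.
  intros H Hx Hf. apply Un_cv_le with (f := fun k => Rabs (f k x)).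
  - apply cv_cvabs, (unif_cv_Un_cv S); trivial.
  - exists 0%nat; intros; apply Hf.
Qed.

Lemma near_solution_weaken (m lam mu d d' : R) (u u1 u2 v v1 v2 : R -> R) : d <= d' ->
  near_solution m lam mu d u u1 u2 v v1 v2 -> near_solution m lam mu d' u u1 u2 v v1 v2.
Proof.
  intros Hd (H1 & H2 & H3 & H4 & H5 & H6 & H7 & H).
  repeat (split; [assumption|]). intros x Hx; destruct (H x Hx); lra.
Qed.

(** From some index on, two members both have defect at most [d] and values at 0 less than [d]
    apart, so stability applies to the pair directly. *)
Lemma near_solutions_cauchy (m lam mu : R) (u u1 u2 v v1 v2 : nat -> R -> R) :
  0 < lam -> 0 < mu ->
  (forall d, 0 < d -> exists N, forall k, (N <= k)%nat ->
     near_solution m lam mu d (u k) (u1 k) (u2 k) (v k) (v1 k) (v2 k)) ->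
  Cauchy_crit (fun k => u k 0) -> Cauchy_crit (fun k => v k 0) ->
  forall eta, 0 < eta -> exists N, forall k l, (N <= k)%nat -> (N <= l)%nat ->
    forall x, in_oI x -> Rabs (u k x - u l x) <= eta /\ Rabs (v k x - v l x) <= eta /\
      Rabs (u1 k x - u1 l x) <= eta /\ Rabs (v1 k x - v1 l x) <= eta.
Proof.
  intros Hlam Hmu Hn Hu Hv eta He.
  set (G := exp (3 + 2 * ((lam + mu) * (2 / m ^ 3)))).
  assert (HG : 0 < G) by apply exp_pos.
  (* The energy is at most [(1 + 1 + 4) * d ^ 2 * G], which does not exceed
     [9 * d ^ 2 * (G + 1) ^ 2 = eta ^ 2]. *)
  set (d := eta / (3 * (G + 1))).
  assert (Hd : 0 < d) by (apply Rdiv_lt_0_compat; lra).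
  destruct (Hn d Hd) as [N HN].
  destruct (Hu d Hd) as [Nu HNu]. destruct (Hv d Hd) as [Nv HNv].
  exists (max N (max Nu Nv)); intros k l Hk Hl x Hx.
  assert (S := near_solution_stability m lam mu d _ _ _ _ _ _ _ _ _ _ _ _ Hlam Hmu (Rlt_le _ _ Hd)
    (HN k ltac:(lia)) (HN l ltac:(lia)) x Hx).
  fold G in S.
  assert (A := HNu k l ltac:(lia) ltac:(lia)). assert (B := HNv k l ltac:(lia) ltac:(lia)).
  unfold R_dist in A, B.
  assert (Hsq : forall a c, 0 <= c -> Rabs a <= c -> a ^ 2 <= c ^ 2).
  { intros a c Hc Ha. rewrite <- (pow2_abs a). apply pow_incr; split; [apply Rabs_pos | trivial]. }
  apply Rlt_le, Hsq in A; [|lra]. apply Rlt_le, Hsq in B; [|lra].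
  assert (E : ((u k 0 - u l 0) ^ 2 + (v k 0 - v l 0) ^ 2 + 4 * d ^ 2) * G <= eta ^ 2).
  { apply Rle_trans with (9 * (d ^ 2) * (G + 1) ^ 2).
    - assert (0 <= d ^ 2) by apply pow2_ge_0.
      apply Rle_trans with (9 * d ^ 2 * G); [apply Rmult_le_compat_r; lra|].
      apply Rmult_le_compat_l; nra.
    - right; unfold d; field; lra. }
  assert (Q1 := pow2_ge_0 (u k x - u l x)). assert (Q2 := pow2_ge_0 (v k x - v l x)).
  assert (Q3 := pow2_ge_0 (u1 k x - u1 l x)). assert (Q4 := pow2_ge_0 (v1 k x - v1 l x)).
  assert (Hab : forall a, a ^ 2 <= eta ^ 2 -> Rabs a <= eta).
  { intros a Ha. rewrite <- (Rabs_pos_eq eta) by lra.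
    apply Rsqr_le_abs_0. unfold Rsqr; lra. }
  repeat split; apply Hab; lra.
Qed.

(** The second derivatives are uniformly close to multiples of the inverse square of the gap, which
    is Lipschitz for gaps at least [m]. Hence they converge uniformly, and differentiating the
    limits twice term by term gives the equations. *)
Lemma near_solutions_limit (m lam mu : R) (u u1 u2 v v1 v2 : nat -> R -> R) :
  0 < lam -> 0 < mu ->
  (forall k, profile m (u k) (u1 k) (u2 k) (v k) (v1 k) (v2 k)) ->
  (forall k, u k (-1) = 0 /\ u k 1 = 0 /\ v k (-1) = -1 /\ v k 1 = -1) ->
  (forall d, 0 < d -> exists N, forall k, (N <= k)%nat ->
     near_solution m lam mu d (u k) (u1 k) (u2 k) (v k) (v1 k) (v2 k)) ->
  Cauchy_crit (fun k => u k 0) -> Cauchy_crit (fun k => v k 0) ->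
  exists u0 u01 u02 v0 v01 v02 : R -> R,
    small_aspect_sol lam mu u0 u01 u02 v0 v01 v02 /\
    W1inf_cv u u1 u0 u01 /\ W1inf_cv v v1 v0 v01 /\
    (forall x, in_I x -> -1 <= v0 x /\ u0 x <= 0 /\ m <= u0 x - v0 x).
Proof.
  intros Hlam Hmu Hp Hbd Hn Cu Cv.
  assert (HC := near_solutions_cauchy m lam mu u u1 u2 v v1 v2 Hlam Hmu Hn Cu Cv).
  assert (Hm : 0 < m) by (destruct (Hp 0%nat) as [? _]; lra).
  assert (HI : forall x, in_I x -> in_oI x \/ x = -1 \/ x = 1).
  { unfold in_I, in_oI; intros x Hx.
    destruct (Req_dec x (-1)); destruct (Req_dec x 1); lra. }
  (* Stability covers the open interval; at the end points the sequence is constant, which gives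
     uniform convergence up to the boundary. *)
  destruct (unif_cv_cauchy in_I u) as [u0 Hu0].
  { intros eta He. destruct (HC eta He) as [N HN]. exists N; intros k l Hk Hl x Hx.
    destruct (Hbd k) as (B1 & B2 & _). destruct (Hbd l) as (B3 & B4 & _).
    destruct (HI x Hx) as [Ho | [-> | ->]].
    - apply HN; trivial.
    - rewrite B1, B3, Rminus_eq_0, Rabs_R0; lra.
    - rewrite B2, B4, Rminus_eq_0, Rabs_R0; lra. }
  destruct (unif_cv_cauchy in_I v) as [v0 Hv0].
  { intros eta He. destruct (HC eta He) as [N HN]. exists N; intros k l Hk Hl x Hx.
    destruct (Hbd k) as (_ & _ & B1 & B2). destruct (Hbd l) as (_ & _ & B3 & B4).
    destruct (HI x Hx) as [Ho | [-> | ->]].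
    - apply HN; trivial.
    - rewrite B1, B3, Rminus_eq_0, Rabs_R0; lra.
    - rewrite B2, B4, Rminus_eq_0, Rabs_R0; lra. }
  destruct (unif_cv_cauchy in_oI u1) as [u01 Hu01].
  { intros eta He. destruct (HC eta He) as [N HN]. exists N; intros k l Hk Hl x Hx.
    apply HN; trivial. }
  destruct (unif_cv_cauchy in_oI v1) as [v01 Hv01].
  { intros eta He. destruct (HC eta He) as [N HN]. exists N; intros k l Hk Hl x Hx.
    apply HN; trivial. }
  assert (Hu0' : unif_cv in_oI u u0).
  { intros eta He; destruct (Hu0 eta He) as [N HN]; exists N; intros; apply HN, in_oI_in_I; trivial. }
  assert (Hv0' : unif_cv in_oI v v0).
  { intros eta He; destruct (Hv0 eta He) as [N HN]; exists N; intros; apply HN, in_oI_in_I; trivial. }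
  assert (Hlim : forall x, in_I x -> -1 <= v0 x /\ u0 x <= 0 /\ m <= u0 x - v0 x).
  { intros x Hx.
    assert (Lu := unif_cv_Un_cv _ _ _ x Hu0 Hx). assert (Lv := unif_cv_Un_cv _ _ _ x Hv0 Hx).
    assert (P : forall k, -1 <= v k x /\ u k x <= 0 /\ m <= u k x - v k x)
      by (intros k; apply (Hp k), Hx).
    repeat split.
    - enough (- v0 x <= 1) by lra.
      apply (Un_cv_le (fun k => - v k x)); [apply (CV_opp _ _ Lv)|].
      exists 0%nat; intros k _; destruct (P k); lra.
    - apply (Un_cv_le (fun k => u k x)); [apply Lu|]. exists 0%nat; intros k _; apply (P k).
    - enough (v0 x - u0 x <= - m) by lra.
      apply (Un_cv_le (fun k => v k x - u k x)); [apply (CV_minus _ _ _ _ Lv Lu)|].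
      exists 0%nat; intros k _; destruct (P k); lra. }
  assert (Hsq : forall eta, 0 < eta -> exists N, forall k, (N <= k)%nat -> forall x, in_oI x ->
     Rabs ((/ (u k x - v k x)) ^ 2 - (/ (u0 x - v0 x)) ^ 2) <= eta).
  { intros eta He.
    assert (P3 : 0 < m ^ 3) by (apply pow_lt; trivial).
    (* Two errors of this size, multiplied by the Lipschitz constant [2 / m ^ 3], add up to
       [eta]. *)
    assert (Hk : 0 < eta * m ^ 3 / 4) by (apply Rdiv_lt_0_compat; [apply Rmult_lt_0_compat|]; lra).
    destruct (Hu0 _ Hk) as [N1 HN1]. destruct (Hv0 _ Hk) as [N2 HN2].
    exists (max N1 N2); intros k Hkk x Hx.
    assert (HxI := in_oI_in_I x Hx).
    apply Rle_trans with (2 / m ^ 3 * Rabs (u k x - v k x - (u0 x - v0 x))).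
    - apply inv_square_lipschitz; trivial; [apply (Hp k), HxI | apply Hlim, HxI].
    - apply Rle_trans with (2 / m ^ 3 * (eta * m ^ 3 / 4 + eta * m ^ 3 / 4)); [|right; field; lra].
      apply Rmult_le_compat_l; [left; apply Rdiv_lt_0_compat; lra|].
      replace (u k x - v k x - (u0 x - v0 x)) with ((u k x - u0 x) - (v k x - v0 x)) by ring.
      apply Rabs_minus_le; [apply HN1 | apply HN2]; trivial; lia. }
  assert (H2 : forall lam (y : nat -> R -> R), 0 < lam ->
    (forall d, 0 < d -> exists N, forall k, (N <= k)%nat -> forall x, in_oI x ->
        Rabs (y k x - lam * (/ (u k x - v k x)) ^ 2) <= d) ->
    unif_cv in_oI y (fun x => lam / (u0 x - v0 x) ^ 2)).
  { intros a y Ha Hy eta He.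
    destruct (Hy (eta / 2)) as [N1 HN1]; [lra|].
    destruct (Hsq (eta / (2 * a))) as [N2 HN2]; [apply Rdiv_lt_0_compat; lra|].
    exists (max N1 N2); intros k Hk x Hx.
    specialize (HN1 k ltac:(lia) x Hx). specialize (HN2 k ltac:(lia) x Hx).
    unfold Rdiv at 1. rewrite <- pow_inv.
    replace (y k x - a * (/ (u0 x - v0 x)) ^ 2)
      with ((y k x - a * (/ (u k x - v k x)) ^ 2) +
            a * ((/ (u k x - v k x)) ^ 2 - (/ (u0 x - v0 x)) ^ 2)) by ring.
    apply Rle_trans with (eta / 2 + a * (eta / (2 * a))); [|right; field; lra].
    apply Rabs_plus_le; trivial. apply Rabs_mult_le; trivial. rewrite Rabs_pos_eq; lra. }
  assert (Hu02 : unif_cv in_oI u2 (fun x => lam / (u0 x - v0 x) ^ 2)).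
  { apply H2; trivial. intros d Hd; destruct (Hn d Hd) as [N HN]; exists N; intros k Hk x Hx.
    apply (HN k Hk), Hx. }
  assert (Hv02 : unif_cv in_oI v2 (fun x => - mu / (u0 x - v0 x) ^ 2)).
  { intros eta He.
    destruct (H2 mu (fun k x => - v2 k x) Hmu) with (eta := eta) as [N HN]; trivial.
    - intros d Hd; destruct (Hn d Hd) as [N HN]; exists N; intros k Hk x Hx.
      rewrite <- Rabs_Ropp.
      replace (- (- v2 k x - mu * (/ (u k x - v k x)) ^ 2))
        with (v2 k x + mu * (/ (u k x - v k x)) ^ 2) by ring.
      apply (HN k Hk), Hx.
    - exists N; intros k Hk x Hx. specialize (HN k Hk x Hx). rewrite <- Rabs_Ropp.
      replace (- (v2 k x - - mu / (u0 x - v0 x) ^ 2)) with (- v2 k x - mu / (u0 x - v0 x) ^ 2)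
        by (unfold Rdiv; ring). trivial. }
  (* Term-by-term differentiation asks for a continuous limit derivative; here it is a uniform limit
     of differentiable functions, and at the next order continuity is visible from the formula. *)
  assert (Du : forall x, in_oI x -> derivable_pt_lim u0 x (u01 x)).
  { apply (unif_cv_derivable u u1); trivial.
    - intros k x Hx; apply (Hp k), Hx.
    - apply (unif_cv_continuity u1 u2); trivial. intros k x Hx; apply (Hp k), Hx. }
  assert (Dv : forall x, in_oI x -> derivable_pt_lim v0 x (v01 x)).
  { apply (unif_cv_derivable v v1); trivial.
    - intros k x Hx; apply (Hp k), Hx.
    - apply (unif_cv_continuity v1 v2); trivial. intros k x Hx; apply (Hp k), Hx. }
  assert (Cq : forall a x, in_oI x -> continuity_pt (fun x => a / (u0 x - v0 x) ^ 2) x).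
  { intros a x Hx. apply continuity_pt_div.
    - apply continuity_pt_const; intros ? ?; trivial.
    - apply (continuity_pt_comp (fun x => u0 x - v0 x) (fun y => y ^ 2)).
      + apply continuity_pt_minus; apply derivable_continuous_pt;
        [exists (u01 x); apply Du | exists (v01 x); apply Dv]; trivial.
      + apply derivable_continuous_pt, derivable_pt_pow.
    - destruct (Hlim x (in_oI_in_I x Hx)). apply pow_nonzero; lra. }
  exists u0, u01, (fun x => lam / (u0 x - v0 x) ^ 2), v0, v01, (fun x => - mu / (u0 x - v0 x) ^ 2).
  split; [|split; [|split; [|trivial]]].
  - split; [|split; [|split; [|split; [|split; [|]]]]].
    + apply (unif_cv_cont_on_I u); trivial. intros k; apply (Hp k).
    + apply (unif_cv_cont_on_I v); trivial. intros k; apply (Hp k).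
    + intros x Hx; repeat split; auto.
      * apply (unif_cv_derivable u1 u2 u01 (fun x => lam / (u0 x - v0 x) ^ 2)); auto.
        intros k y Hy; apply (Hp k), Hy.
      * apply (unif_cv_derivable v1 v2 v01 (fun x => - mu / (u0 x - v0 x) ^ 2)); auto.
        intros k y Hy; apply (Hp k), Hy.
    + exists 3; intros x Hx. repeat split.
      * apply (unif_cv_abs_le in_oI u1); trivial; intros k; apply (Hp k), Hx.
      * apply (unif_cv_abs_le in_oI u2 (fun x => lam / (u0 x - v0 x) ^ 2)); trivial; intros k; apply (Hp k), Hx.
      * apply (unif_cv_abs_le in_oI v1); trivial; intros k; apply (Hp k), Hx.
      * apply (unif_cv_abs_le in_oI v2 (fun x => - mu / (u0 x - v0 x) ^ 2)); trivial; intros k; apply (Hp k), Hx.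
    + intros x Hx; split; trivial.
    + assert (Hc : forall (f : nat -> R -> R) g x c, unif_cv in_I f g -> in_I x -> (forall k, f k x = c) -> g x = c).
      { intros f g x c Hf Hx Hk. apply (UL_sequence (fun k => f k x)).
        - apply (unif_cv_Un_cv in_I); trivial.
        - intros e0 He0; exists 0%nat; intros. rewrite Hk. unfold R_dist; rewrite Rminus_eq_0, Rabs_R0; trivial. }
      repeat split.
      * apply (Hc u); trivial; [unfold in_I; lra | apply Hbd].
      * apply (Hc u); trivial; [unfold in_I; lra | apply Hbd].
      * apply (Hc v); trivial; [unfold in_I; lra | apply Hbd].
      * apply (Hc v); trivial; [unfold in_I; lra | apply Hbd].
      * intros x Hx; destruct (Hlim x Hx); lra.
  - intros eta He. destruct (Hu0' eta He) as [N1 HN1]. destruct (Hu01 eta He) as [N2 HN2].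
    exists (max N1 N2); intros k Hk x Hx; split; [apply HN1 | apply HN2]; trivial; lia.
  - intros eta He. destruct (Hv0' eta He) as [N1 HN1]. destruct (Hv01 eta He) as [N2 HN2].
    exists (max N1 N2); intros k Hk x Hx; split; [apply HN1 | apply HN2]; trivial; lia.
Qed.

(** Bolzano-Weierstrass gives a cluster point [l]; [s n] is an index beyond [n] with error below
    [/ (INR n + 1)]. The property [n <= s n] already carries limits over to the selected
    sequence. *)
Lemma bounded_cv_subsequence (f : nat -> R) (a b : R) : (forall n, a <= f n <= b) ->
  exists (s : nat -> nat) (l : R), (forall n, (n <= s n)%nat) /\ Un_cv (fun n => f (s n)) l.
Proof.
  intros Hf.
  destruct (Bolzano_Weierstrass f (fun c => a <= c <= b) (compact_P3 a b) Hf) as [l Hl].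
  assert (Hs : forall n, exists p, (n <= p)%nat /\ Rabs (f p - l) < / (INR n + 1)).
  { intros n. assert (Hn : 0 < / (INR n + 1)) by (apply Rinv_0_lt_compat; pose proof (pos_INR n); lra).
    destruct (Hl (disc l (mkposreal _ Hn)) n) as (p & Hp & Hd).
    - exists (mkposreal _ Hn). intros y Hy; exact Hy.
    - exists p; split; trivial. }
  destruct (functional_choice _ Hs) as [s Hs'].
  exists s, l; split; [apply Hs'|].
  intros eta He. destruct (archimed_cor1 eta He) as (N & HN & HN0).
  exists N; intros n Hn. apply Rlt_trans with (1 := proj2 (Hs' n)).
  apply Rle_lt_trans with (/ INR N); trivial.
  apply Rinv_le_contravar; [apply lt_0_INR; trivial|]. apply le_INR in Hn; lra.
Qed.

(** Near 0 the function agrees with its reflection, so the derivative at 0 equals its own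
    negative. *)
Lemma derivable_pt_lim_even (f : R -> R) (l : R) :
  (forall x, in_I x -> f (- x) = f x) -> derivable_pt_lim f 0 l -> l = 0.
Proof.
  intros He Hl.
  assert (H1 : derivable_pt_lim (fun t => f (- t)) 0 (- l))
    by (apply derivable_pt_lim_reflect; rewrite Ropp_0; trivial).
  assert (H2 : derivable_pt_lim f 0 (- l)).
  { intros eta Heta. destruct (H1 eta Heta) as [d Hd].
    (* Evenness is known only on the closed interval, so increments are kept below 1. *)
    assert (Hm : 0 < Rmin d 1) by (apply Rmin_glb_lt; [apply cond_pos | lra]).
    exists (mkposreal _ Hm). simpl; intros h Hh0 Hh.
    assert (M1 := Rmin_l d 1). assert (M2 := Rmin_r d 1).
    specialize (Hd h Hh0 ltac:(lra)). apply Rabs_def2 in Hh.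
    rewrite (He (0 + h)), (He 0) in Hd; trivial; unfold in_I; lra. }
  assert (E := uniqueness_limite f 0 _ _ Hl H2). lra.
Qed.

(** * Convergence of the potentials *)

Lemma continuity_pt_Rmax (f g : R -> R) (x : R) :
  continuity_pt f x -> continuity_pt g x -> continuity_pt (fun t => Rmax (f t) (g t)) x.
Proof.
  intros Hf Hg eta He.
  destruct (Hf eta He) as (d1 & Hd1 & H1). destruct (Hg eta He) as (d2 & Hd2 & H2).
  exists (Rmin d1 d2); split; [apply Rmin_glb_lt; trivial|].
  intros y [Hy Hyd].
  assert (M1 := Rmin_l d1 d2). assert (M2 := Rmin_r d1 d2).
  assert (A := H1 y (conj Hy (Rlt_le_trans _ _ _ Hyd M1))).
  assert (B := H2 y (conj Hy (Rlt_le_trans _ _ _ Hyd M2))).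
  simpl in A, B |- *; unfold R_dist in *. apply Rabs_def2 in A, B.
  unfold Rmax; destruct (Rle_dec (f y) (g y)); destruct (Rle_dec (f x) (g x)); apply Rabs_def1; lra.
Qed.

Lemma continuity_pt_Rmin (f g : R -> R) (x : R) :
  continuity_pt f x -> continuity_pt g x -> continuity_pt (fun t => Rmin (f t) (g t)) x.
Proof.
  intros Hf Hg.
  apply continuity_pt_ext with (f := fun t => - Rmax (- f t) (- g t)).
  - intros t; rewrite Ropp_Rmax, !Ropp_involutive; trivial.
  - apply continuity_pt_opp, continuity_pt_Rmax; apply continuity_pt_opp; trivial.
Qed.

Lemma continuity_2d_pt_snd (h : R -> R -> R) (x z : R) :
  continuity_2d_pt h x z -> continuity_pt (h x) z.
Proof.
  intros H eta He. destruct (H (mkposreal eta He)) as [d Hd].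
  exists d; split; [apply cond_pos|].
  intros y [_ Hy]; apply Hd; [rewrite Rminus_eq_0, Rabs_R0; apply cond_pos | exact Hy].
Qed.

Lemma continuity_ex_RInt (f : R -> R) (a b : R) : (forall z, continuity_pt f z) -> ex_RInt f a b.
Proof. intros H. apply (@ex_RInt_continuous R_CompleteNormedModule). intros z _. apply continuity_pt_filterlim, H. Qed.

Lemma abs_RInt_le_const_any (f : R -> R) (a b M : R) : (forall z, continuity_pt f z) ->
  (forall z, Rmin a b <= z <= Rmax a b -> Rabs (f z) <= M) -> Rabs (RInt f a b) <= M * Rabs (b - a).
Proof.
  intros Hf HM. destruct (Rle_dec a b) as [H|H].
  - rewrite Rmin_left, Rmax_right in HM by lra.
    rewrite (Rabs_pos_eq (b - a)), Rmult_comm by lra.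
    apply abs_RInt_le_const; trivial. apply continuity_ex_RInt, Hf.
  - rewrite Rmin_right, Rmax_left in HM by lra.
    rewrite <- (opp_RInt_swap f b a) by (apply continuity_ex_RInt, Hf).
    change (opp (RInt f b a)) with (- RInt f b a).
    rewrite Rabs_Ropp, Rabs_minus_sym, (Rabs_pos_eq (a - b)), Rmult_comm by lra.
    apply abs_RInt_le_const; [lra | apply continuity_ex_RInt, Hf | trivial].
Qed.

(** The increment splits into the integral of [h y - h x] up to [b x], small by uniform continuity,
    and the integral of [h y] between [b x] and [b y], small because [h] is bounded on a
    rectangle. *)
Lemma RInt_param_bound_continuity (h : R -> R -> R) (b : R -> R) (c d : R) :
  (forall x z, continuity_2d_pt h x z) -> (forall x, c <= b x <= d) ->
  (forall x, continuity_pt b x) -> forall x, continuity_pt (fun x => RInt (h x) c (b x)) x.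
Proof.
  intros Hh Hb Cb x eta He.
  assert (Hcd : c <= d) by (specialize (Hb x); lra).
  (* The maximum of the square bounds [h] from both sides at once, through [|t| <= t ^ 2 + 1]. *)
  destruct (rectangle_max (fun x z => h x z * h x z) (x - 1) (x + 1) c d) as (xm & zm & _ & _ & Hmax);
    [lra | trivial | intros; apply continuity_2d_pt_mult; apply Hh |].
  set (M := h xm zm * h xm zm + 1) in *.
  assert (HM0 : 0 <= h xm zm * h xm zm) by apply Rle_0_sqr.
  assert (HM : forall y z, x - 1 <= y <= x + 1 -> c <= z <= d -> Rabs (h y z) <= M).
  { intros y z Hy Hz. specialize (Hmax y z Hy Hz). unfold M.
    apply Rabs_le; split; nra. }
  assert (P1 : 0 < eta / (2 * (d - c + 1))) by (apply Rdiv_lt_0_compat; lra).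
  assert (P2 : 0 < eta / (2 * M)) by (apply Rdiv_lt_0_compat; unfold M; lra).
  destruct (uniform_continuity_2d h (x - 1) (x + 1) c d (fun y z _ _ => Hh y z) (mkposreal _ P1))
    as [dh Hdh]; simpl in Hdh.
  destruct (Cb x _ P2) as (db & Hdb & Kb).
  exists (Rmin 1 (Rmin dh db)).
  split; [repeat apply Rmin_glb_lt; trivial; [lra | apply cond_pos]|].
  intros y [Hy Hyd]; simpl in y, Hyd |- *.
  assert (M1 := Rmin_l 1 (Rmin dh db)). assert (M2 := Rmin_r 1 (Rmin dh db)).
  assert (M3 := Rmin_l dh db). assert (M4 := Rmin_r dh db).
  specialize (Kb y (conj Hy (Rlt_le_trans _ _ _ Hyd (Rle_trans _ _ _ M2 M4)))); simpl in Kb; unfold R_dist in *.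
  assert (Hyx := Rabs_def2 _ _ Hyd).
  assert (C1 : forall y z, continuity_pt (h y) z) by (intros; apply continuity_2d_pt_snd, Hh).
  assert (E1 : RInt (h y) c (b y) = RInt (h y) c (b x) + RInt (h y) (b x) (b y)).
  { symmetry. apply (RInt_Chasles (h y)); apply continuity_ex_RInt; auto. }
  assert (E2 : RInt (h y) c (b x) - RInt (h x) c (b x) = RInt (fun z => h y z - h x z) c (b x)).
  { symmetry. apply (RInt_minus (h y) (h x)); apply continuity_ex_RInt; auto. }
  rewrite E1.
  replace (RInt (h y) c (b x) + RInt (h y) (b x) (b y) - RInt (h x) c (b x))
    with (RInt (fun z => h y z - h x z) c (b x) + RInt (h y) (b x) (b y)) by (rewrite <- E2; ring).
  assert (Bx := Hb x). assert (By := Hb y).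
  apply Rle_lt_trans with (eta / (2 * (d - c + 1)) * Rabs (b x - c) + M * Rabs (b y - b x)).
  - apply Rabs_plus_le; apply abs_RInt_le_const_any; auto.
    + intros z; apply (continuity_pt_minus (h y) (h x)); auto.
    + rewrite Rmin_left, Rmax_right by lra. intros z Hz. left.
      apply Hdh; try lra. rewrite Rminus_eq_0, Rabs_R0; apply cond_pos.
    + intros z Hz. apply HM; [lra|].
      unfold Rmin, Rmax in Hz; destruct (Rle_dec (b x) (b y)); lra.
  - rewrite (Rabs_pos_eq (b x - c)) by lra.
    assert (eta / (2 * (d - c + 1)) * (b x - c) <= eta / (2 * (d - c + 1)) * (d - c + 1))
      by (apply Rmult_le_compat_l; lra).
    assert (HM1 : 0 < M) by (unfold M; lra).
    assert (M * Rabs (b y - b x) < M * (eta / (2 * M))) by (apply Rmult_lt_compat_l; trivial).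
    replace (eta / (2 * (d - c + 1)) * (d - c + 1)) with (eta / 2) in * by (field; lra).
    replace (M * (eta / (2 * M))) with (eta / 2) in * by (field; lra).
    lra.
Qed.

Lemma RInt_param_bounds_continuity (h : R -> R -> R) (a b : R -> R) (c d : R) :
  (forall x z, continuity_2d_pt h x z) ->
  (forall x, c <= a x <= d) -> (forall x, c <= b x <= d) ->
  (forall x, continuity_pt a x) -> (forall x, continuity_pt b x) ->
  forall x, continuity_pt (fun x => RInt (h x) (a x) (b x)) x.
Proof.
  intros Hh Ha Hb Ca Cb x.
  apply continuity_pt_ext with (f := fun x => RInt (h x) c (b x) - RInt (h x) c (a x)).
  - intros t.
    assert (C1 : forall z, continuity_pt (h t) z) by (intros; apply continuity_2d_pt_snd, Hh).
    assert (E : RInt (h t) c (a t) + RInt (h t) (a t) (b t) = RInt (h t) c (b t))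
      by (apply (RInt_Chasles (h t)); apply continuity_ex_RInt; auto).
    lra.
  - apply continuity_pt_minus; apply RInt_param_bound_continuity with (d := d); trivial.
Qed.

(** * Slice integrals of cut-off functions *)

Definition ind1 (a b z : R) : R :=
  if Rlt_dec a z then if Rlt_dec z b then 1 else 0 else 0.

Lemma ind_Omega_ind1 (u v : R -> R) (x z : R) : in_oI x -> ind_Omega u v x z = ind1 (v x) (u x) z.
Proof.
  intros Hx; unfold ind_Omega, ind1, in_oI in *.
  destruct (Rlt_dec (-1) x); [|lra]. destruct (Rlt_dec x 1); [trivial | lra].
Qed.

Lemma ind1_inside (a b z : R) : a < z < b -> ind1 a b z = 1.
Proof. intros H; unfold ind1; destruct (Rlt_dec a z); [destruct (Rlt_dec z b)|]; lra. Qed.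

Lemma ind1_outside (a b z : R) : ~ (a < z < b) -> ind1 a b z = 0.
Proof. intros H; unfold ind1; destruct (Rlt_dec a z); [destruct (Rlt_dec z b)|]; lra. Qed.

Lemma is_RInt_ind1 (f : R -> R) (a b c d : R) : (forall z, continuity_pt f z) ->
  c <= a <= b -> b <= d -> is_RInt (fun z => f z * ind1 a b z) c d (RInt f a b).
Proof.
  intros Hf Hab Hd.
  assert (H0 : forall s t, s <= t -> (t <= a \/ b <= s) -> is_RInt (fun z => f z * ind1 a b z) s t 0).
  { intros s t Hst Ho.
    apply is_RInt_ext with (f := fun _ => 0).
    - rewrite Rmin_left, Rmax_right by trivial. intros z Hz.
      change (0 = f z * ind1 a b z); rewrite ind1_outside; [ring | lra].
    - assert (E := @is_RInt_const R_NormedModule s t 0).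
      change (scal (t - s) 0) with ((t - s) * 0) in E. rewrite Rmult_0_r in E. exact E. }
  replace (RInt f a b) with (plus (plus 0 (RInt f a b)) 0)
    by (unfold plus; simpl; ring).
  apply (@is_RInt_Chasles R_NormedModule) with b; [apply (@is_RInt_Chasles R_NormedModule) with a|].
  - apply H0; lra.
  - apply is_RInt_ext with (f := f).
    + rewrite Rmin_left, Rmax_right by lra. intros z Hz. change (f z = f z * ind1 a b z).
      rewrite ind1_inside by trivial. ring.
    + apply (@RInt_correct R_CompleteNormedModule), continuity_ex_RInt, Hf.
  - apply H0; lra.
Qed.

Lemma ind1_mult (a b a' b' z : R) : ind1 a b z * ind1 a' b' z = ind1 (Rmax a a') (Rmin b b') z.
Proof.
  unfold ind1, Rmax, Rmin.
  destruct (Rlt_dec a z), (Rlt_dec z b), (Rlt_dec a' z), (Rlt_dec z b');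
  destruct (Rle_dec a a'), (Rle_dec b b');
  repeat match goal with |- context [Rlt_dec ?x ?y] => destruct (Rlt_dec x y) end; lra.
Qed.

(** Expanding the square turns products of indicators into indicators of intervals. Only integrals
    of continuous functions with moving limits remain, and these depend continuously on the
    slice. *)
Lemma is_RInt_slice (p q : R -> R) (a b a' b' c d : R) :
  (forall z, continuity_pt p z) -> (forall z, continuity_pt q z) ->
  c <= a -> c <= a' -> b <= d -> b' <= d -> Rmax a a' <= Rmin b b' ->
  is_RInt (fun z => (p z * ind1 a b z - q z * ind1 a' b' z) ^ 2) c d
    (RInt (fun z => p z * p z) a b + RInt (fun z => q z * q z) a' b'
     - 2 * RInt (fun z => p z * q z) (Rmax a a') (Rmin b b')).
Proof.
  intros Hp Hq H1 H2 H3 H4 H5.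
  assert (M1 := Rmax_l a a'). assert (M2 := Rmax_r a a').
  assert (M3 := Rmin_l b b'). assert (M4 := Rmin_r b b').
  assert (Hpp : forall z, continuity_pt (fun z => p z * p z) z)
    by (intros; apply (continuity_pt_mult p p); trivial).
  assert (Hqq : forall z, continuity_pt (fun z => q z * q z) z)
    by (intros; apply (continuity_pt_mult q q); trivial).
  assert (Hpq : forall z, continuity_pt (fun z => p z * q z) z)
    by (intros; apply (continuity_pt_mult p q); trivial).
  apply is_RInt_ext with (f := fun z => minus (plus (p z * p z * ind1 a b z) (q z * q z * ind1 a' b' z))
     (scal 2 (p z * q z * ind1 (Rmax a a') (Rmin b b') z))).
  - intros z _. rewrite <- ind1_mult.
    assert (S : forall s t, ind1 s t z = ind1 s t z * ind1 s t z)
      by (intros; rewrite ind1_mult, Rmax_left, Rmin_left by lra; trivial).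
    change (p z * p z * ind1 a b z + q z * q z * ind1 a' b' z - 2 * (p z * q z * (ind1 a b z * ind1 a' b' z))
      = (p z * ind1 a b z - q z * ind1 a' b' z) ^ 2).
    rewrite (S a b), (S a' b') at 1.
    ring.
  - apply (@is_RInt_minus R_NormedModule); [apply (@is_RInt_plus R_NormedModule)|].
    + apply (is_RInt_ind1 (fun z => p z * p z)); trivial; lra.
    + apply (is_RInt_ind1 (fun z => q z * q z)); trivial; lra.
    + apply (@is_RInt_scal R_NormedModule). apply (is_RInt_ind1 (fun z => p z * q z)); trivial; lra.
Qed.

(** Both square terms are cut down to the overlap of the two intervals, at a cost of 4 per unit of
    excess length since [|p|] and [|q|] are at most 2. On the overlap the three integrals recombine
    to that of [(p - q) ^ 2]. *)
Lemma slice_bound (p q : R -> R) (a b a' b' s : R) :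
  (forall z, continuity_pt p z) -> (forall z, continuity_pt q z) ->
  (forall z, Rabs (p z) <= 2) -> (forall z, Rabs (q z) <= 2) ->
  Rmax a a' <= Rmin b b' ->
  (forall z, Rmax a a' <= z <= Rmin b b' -> (p z - q z) ^ 2 <= s) ->
  RInt (fun z => p z * p z) a b + RInt (fun z => q z * q z) a' b'
     - 2 * RInt (fun z => p z * q z) (Rmax a a') (Rmin b b') <=
  s * (Rmin b b' - Rmax a a') + 4 * (Rabs (a - a') + Rabs (b - b')).
Proof.
  intros Hp Hq Bp Bq Hle Hs.
  assert (Hpp : forall z, continuity_pt (fun z => p z * p z) z)
    by (intros; apply (continuity_pt_mult p p); trivial).
  assert (Hqq : forall z, continuity_pt (fun z => q z * q z) z)
    by (intros; apply (continuity_pt_mult q q); trivial).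
  assert (Hpq : forall z, continuity_pt (fun z => p z * q z) z)
    by (intros; apply (continuity_pt_mult p q); trivial).
  assert (Hcut : forall f s t, (forall z, continuity_pt f z) -> (forall z, Rabs (f z) <= 2) ->
     RInt (fun z => f z * f z) s t <= RInt (fun z => f z * f z) (Rmax a a') (Rmin b b')
       + 4 * (Rabs (Rmax a a' - s) + Rabs (t - Rmin b b'))).
  { intros f s0 t0 Hf Bf.
    assert (Hff : forall z, continuity_pt (fun z => f z * f z) z)
      by (intros; apply (continuity_pt_mult f f); trivial).
    assert (I : forall x y, ex_RInt (fun z => f z * f z) x y) by (intros; apply continuity_ex_RInt, Hff).
    assert (E1 : RInt (fun z => f z * f z) s0 (Rmax a a') + RInt (fun z => f z * f z) (Rmax a a') t0
                 = RInt (fun z => f z * f z) s0 t0)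
      by (apply (RInt_Chasles (fun z => f z * f z)); trivial).
    assert (E2 : RInt (fun z => f z * f z) (Rmax a a') (Rmin b b') + RInt (fun z => f z * f z) (Rmin b b') t0
                 = RInt (fun z => f z * f z) (Rmax a a') t0)
      by (apply (RInt_Chasles (fun z => f z * f z)); trivial).
    assert (B : forall x y, RInt (fun z => f z * f z) x y <= 2 * 2 * Rabs (y - x)).
    { intros x y. apply Rle_trans with (1 := Rle_abs _). apply abs_RInt_le_const_any; trivial.
      intros z _. apply Rabs_mult_le; trivial. }
    assert (B1 := B s0 (Rmax a a')). assert (B2 := B (Rmin b b') t0). lra. }
  assert (A1 := Hcut p a b Hp Bp). assert (A2 := Hcut q a' b' Hq Bq).
  assert (R1 : Rabs (Rmax a a' - a) + Rabs (Rmax a a' - a') = Rabs (a - a')).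
  { unfold Rmax; destruct (Rle_dec a a'); rewrite Rminus_eq_0, Rabs_R0, (Rabs_minus_sym a a'); [ring|].
    rewrite (Rabs_minus_sym a' a); ring. }
  assert (R2 : Rabs (b - Rmin b b') + Rabs (b' - Rmin b b') = Rabs (b - b')).
  { unfold Rmin; destruct (Rle_dec b b'); rewrite Rminus_eq_0, Rabs_R0; [|ring].
    rewrite (Rabs_minus_sym b' b); ring. }
  assert (E : RInt (fun z => p z * p z) (Rmax a a') (Rmin b b') + RInt (fun z => q z * q z) (Rmax a a') (Rmin b b')
      - 2 * RInt (fun z => p z * q z) (Rmax a a') (Rmin b b')
      = RInt (fun z => (p z - q z) ^ 2) (Rmax a a') (Rmin b b')).
  { symmetry. apply (@is_RInt_unique R_CompleteNormedModule).
    apply is_RInt_ext with (f := fun z => minus (plus (p z * p z) (q z * q z)) (scal 2 (p z * q z))).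
    - intros z _.
      change (p z * p z + q z * q z - 2 * (p z * q z) = (p z - q z) ^ 2). ring.
    - apply (@is_RInt_minus R_NormedModule); [apply (@is_RInt_plus R_NormedModule)|apply (@is_RInt_scal R_NormedModule)];
      apply (@RInt_correct R_CompleteNormedModule), continuity_ex_RInt; trivial. }
  assert (Hc2 : forall z, continuity_pt (fun z => (p z - q z) ^ 2) z).
  { intros z. apply (continuity_pt_comp (fun z => p z - q z) (fun y => y ^ 2)).
    - apply continuity_pt_minus; trivial.
    - apply derivable_continuous_pt, derivable_pt_pow. }
  assert (L : RInt (fun z => (p z - q z) ^ 2) (Rmax a a') (Rmin b b') <= s * (Rmin b b' - Rmax a a')).
  { apply Rle_trans with (1 := Rle_abs _).
    rewrite Rmult_comm. apply abs_RInt_le_const; trivial; [apply continuity_ex_RInt; trivial|].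
    intros z Hz. rewrite Rabs_pos_eq by apply pow2_ge_0. auto. }
  lra.
Qed.

Lemma psi_unit (u v : R -> R) (x z : R) : v x < u x -> v x <= z <= u x -> 0 <= psi u v x z <= 1.
Proof.
  intros H Hz; unfold psi; split.
  - apply Rle_mult_inv_pos; lra.
  - apply Rmult_le_reg_r with (u x - v x); [lra|].
    unfold Rdiv; rewrite Rmult_assoc, Rinv_l; lra.
Qed.

Lemma psi_lipschitz (m d : R) (u v u0 v0 : R -> R) (x z : R) :
  0 < m -> m <= u x - v x -> m <= u0 x - v0 x -> v0 x <= z <= u0 x ->
  Rabs (u x - u0 x) <= d -> Rabs (v x - v0 x) <= d ->
  Rabs (psi u v x z - psi u0 v0 x z) <= 3 * d / m.
Proof.
  intros Hm Hw Hw0 Hz Hu Hv.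
  assert (Hq : 0 < / (u x - v x) <= / m)
    by (split; [apply Rinv_0_lt_compat | apply Rinv_le_contravar]; lra).
  assert (Hp := psi_unit u0 v0 x z ltac:(lra) Hz).
  (* This form of the difference contains only [psi u0 v0], which lies in the unit interval at [z];
     the three errors of size [d] give the factor 3. *)
  replace (psi u v x z - psi u0 v0 x z)
    with ((- (v x - v0 x) + psi u0 v0 x z * ((v x - v0 x) - (u x - u0 x))) * / (u x - v x))
    by (unfold psi; field; lra).
  replace (3 * d / m) with ((d + 1 * (d + d)) * / m) by (field; lra).
  rabs; trivial; rewrite Rabs_pos_eq; lra.
Qed.

(** On the overlap the integrand is at most [(s + 3 * d / m) ^ 2], which is below its root as that
    is at most 1, and the overlap has length at most 1. The excess costs [4 * (d + d)], and 2 is the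
    length of the [x]-interval. The condition [d <= m] makes the two slices overlap. *)
Lemma L2_estimate (m d s : R) (u u1 u2 v v1 v2 u0 v0 : R -> R) (phi : R -> R -> R) :
  profile m u u1 u2 v v1 v2 -> cont_on_I u0 -> cont_on_I v0 ->
  (forall x, in_I x -> -1 <= v0 x /\ u0 x <= 0 /\ m <= u0 x - v0 x) ->
  cont2_on (in_clOmega u v) phi ->
  (forall x z, in_clOmega u v x z -> Rabs (phi x z - psi u v x z) <= s) ->
  (forall x, in_oI x -> Rabs (u x - u0 x) <= d /\ Rabs (v x - v0 x) <= d) ->
  d <= m -> s + 3 * d / m <= 1 ->
  iter_int_le (fun x z => (phi x z * ind_Omega u v x z - psi u0 v0 x z * ind_Omega u0 v0 x z) ^ 2)
    (-1) 1 (-1) 0 (2 * (s + 3 * d / m + 8 * d)).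
Proof.
  intros (Hm & (Cu & _) & (Cv & _) & Hw & _) Cu0 Cv0 Hw0 Cphi Hs Hd Hdm Hs1.
  assert (Hlt : forall x, in_I x -> v x < u x) by (intros x Hx; destruct (Hw x Hx); lra).
  assert (Hlt0 : forall x, in_I x -> v0 x < u0 x) by (intros x Hx; destruct (Hw0 x Hx); lra).
  set (P := clamp_fun2 u v phi). set (Q := clamp_fun2 u0 v0 (psi u0 v0)).
  assert (CP : forall x z, continuity_2d_pt P x z)
    by (apply clamp_fun2_continuity; trivial; intros; apply Rlt_le; auto).
  assert (CQ : forall x z, continuity_2d_pt Q x z).
  { apply clamp_fun2_continuity; trivial; [intros; apply Rlt_le; auto|].
    apply psi_cont2; trivial. }
  assert (Hd0 : 0 <= d).
  { assert (H0 : in_oI 0) by (unfold in_oI; lra). destruct (Hd 0 H0) as [A _].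
    pose proof (Rabs_pos (u 0 - u0 0)); lra. }
  assert (H3d : 0 <= 3 * d / m) by (apply Rle_mult_inv_pos; lra).
  assert (BP : forall x z, Rabs (P x z) <= 2).
  { intros x z. unfold P, clamp_fun2.
    assert (Hin := clamp_fun2_in u v x z (fun x Hx => Rlt_le _ _ (Hlt x Hx))).
    assert (A := Hs _ _ Hin). destruct Hin as [Hx Hz].
    assert (B := psi_unit u v _ _ (Hlt _ Hx) Hz).
    apply Rabs_le_between in A. apply Rabs_le; lra. }
  assert (BQ : forall x z, Rabs (Q x z) <= 2).
  { intros x z. unfold Q, clamp_fun2.
    destruct (clamp_fun2_in u0 v0 x z (fun x Hx => Rlt_le _ _ (Hlt0 x Hx))) as [Hx Hz].
    assert (B := psi_unit u0 v0 _ _ (Hlt0 _ Hx) Hz). apply Rabs_le; lra. }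
  set (F := fun x z => (phi x z * ind_Omega u v x z - psi u0 v0 x z * ind_Omega u0 v0 x z) ^ 2).
  (* Clamped integrands and limits make [G] continuous on the whole line, while it agrees with the
     slice integral of [F] on the open interval. *)
  set (G := fun x => RInt (fun z => P x z * P x z) (clamp_fun v x) (clamp_fun u x)
     + RInt (fun z => Q x z * Q x z) (clamp_fun v0 x) (clamp_fun u0 x)
     - 2 * RInt (fun z => P x z * Q x z) (Rmax (clamp_fun v x) (clamp_fun v0 x))
                                     (Rmin (clamp_fun u x) (clamp_fun u0 x))).
  assert (Hid : forall x (f : R -> R), in_oI x -> clamp_fun f x = f x)
    by (intros x f Hx; unfold clamp_fun; rewrite clampI_id; [trivial | apply in_oI_in_I, Hx]).
  assert (Hord : forall x, in_oI x -> Rmax (v x) (v0 x) <= Rmin (u x) (u0 x)).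
  { intros x Hx. destruct (Hd x Hx) as [A B]. apply Rabs_le_between in A, B.
    destruct (Hw x (in_oI_in_I x Hx)) as (_ & _ & W). destruct (Hw0 x (in_oI_in_I x Hx)) as (_ & _ & W0).
    apply Rmax_lub; apply Rmin_glb; lra. }
  assert (HF : forall x, in_oI x -> is_RInt (F x) (-1) 0 (G x)).
  { intros x Hx. unfold G. rewrite !(Hid x) by trivial.
    destruct (Hw x (in_oI_in_I x Hx)) as (W1 & W2 & _). destruct (Hw0 x (in_oI_in_I x Hx)) as (W3 & W4 & _).
    apply is_RInt_ext with (f := fun z => (P x z * ind1 (v x) (u x) z - Q x z * ind1 (v0 x) (u0 x) z) ^ 2).
    - assert (X : forall (a b : R -> R) f z,
        clamp_fun2 a b f x z * ind1 (b x) (a x) z = f x z * ind1 (b x) (a x) z).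
      { intros a b f z. destruct (classic (b x < z < a x)) as [Hz|Hz].
        - rewrite clamp_fun2_id; [trivial|]. split; [apply in_oI_in_I, Hx | lra].
        - rewrite ind1_outside by trivial. ring. }
      intros z _. unfold F, P, Q. rewrite !X, !ind_Omega_ind1 by trivial. reflexivity.
    - apply is_RInt_slice; auto; intros; apply continuity_2d_pt_snd; auto. }
  assert (HG : forall x, continuity_pt G x).
  { assert (Cb : forall f, cont_on_I f -> (forall x, in_I x -> -1 <= f x <= 0) ->
      (forall x, -1 <= clamp_fun f x <= 0) /\ (forall x, continuity_pt (clamp_fun f) x)).
    { intros f Hf Hb; split; [intros x; apply Hb, clampI_in | apply clamp_fun_continuity, Hf]. }
    destruct (Cb u Cu) as [Bu Ku]; [intros x Hx; destruct (Hw x Hx); lra|].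
    destruct (Cb v Cv) as [Bv Kv]; [intros x Hx; destruct (Hw x Hx); lra|].
    destruct (Cb u0 Cu0) as [Bu0 Ku0]; [intros x Hx; destruct (Hw0 x Hx); lra|].
    destruct (Cb v0 Cv0) as [Bv0 Kv0]; [intros x Hx; destruct (Hw0 x Hx); lra|].
    intros x. apply continuity_pt_minus; [apply continuity_pt_plus|].
    - apply (RInt_param_bounds_continuity (fun x z => P x z * P x z)) with (c := -1) (d := 0); trivial.
      intros; apply continuity_2d_pt_mult; trivial.
    - apply (RInt_param_bounds_continuity (fun x z => Q x z * Q x z)) with (c := -1) (d := 0); trivial.
      intros; apply continuity_2d_pt_mult; trivial.
    - apply continuity_pt_mult; [apply continuity_pt_const; intros ? ?; trivial|].
      apply (RInt_param_bounds_continuity (fun x z => P x z * Q x z)) with (c := -1) (d := 0).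
      + intros; apply continuity_2d_pt_mult; trivial.
      + intros y. apply Rmax_case; trivial.
      + intros y. apply Rmin_case; trivial.
      + intros; apply continuity_pt_Rmax; trivial.
      + intros; apply continuity_pt_Rmin; trivial. }
  assert (HGb : forall x, in_oI x -> G x <= s + 3 * d / m + 8 * d).
  { intros x Hx. unfold G. rewrite !(Hid x) by trivial.
    destruct (Hd x Hx) as [A B].
    destruct (Hw x (in_oI_in_I x Hx)) as (W1 & W2 & W). destruct (Hw0 x (in_oI_in_I x Hx)) as (W3 & W4 & W0).
    assert (O := Hord x Hx).
    assert (M1 := Rmax_l (v x) (v0 x)). assert (M2 := Rmax_r (v x) (v0 x)).
    assert (M3 := Rmin_l (u x) (u0 x)). assert (M4 := Rmin_r (u x) (u0 x)).
    assert (S0 : 0 <= s).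
    { apply Rle_trans with (1 := Rabs_pos (phi x (u x) - psi u v x (u x))).
      apply Hs; split; [apply in_oI_in_I, Hx | lra]. }
    apply Rle_trans with ((s + 3 * d / m) * (Rmin (u x) (u0 x) - Rmax (v x) (v0 x))
        + 4 * (Rabs (v x - v0 x) + Rabs (u x - u0 x))).
    - apply slice_bound; auto; try (intros; apply continuity_2d_pt_snd; auto).
      intros z Hz. unfold P, Q.
      assert (Z1 : in_clOmega u v x z) by (split; [apply in_oI_in_I, Hx | lra]).
      assert (Z0 : in_clOmega u0 v0 x z) by (split; [apply in_oI_in_I, Hx | lra]).
      rewrite !clamp_fun2_id by trivial.
      assert (K1 := Hs x z Z1).
      assert (K2 := psi_lipschitz m d u v u0 v0 x z (proj1 Hm) W W0 (proj2 Z0) A B).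
      assert (K : Rabs (phi x z - psi u0 v0 x z) <= s + 3 * d / m).
      { replace (phi x z - psi u0 v0 x z)
          with ((phi x z - psi u v x z) + (psi u v x z - psi u0 v0 x z)) by ring.
        apply Rabs_plus_le; trivial. }
      rewrite <- pow2_abs. assert (K0 := Rabs_pos (phi x z - psi u0 v0 x z)). nra.
    - nra. }
  exists (fun x => RInt (F x) (-1) 0); split.
  - intros x Hx.
    assert (Hex : ex_RInt (F x) (-1) 0).
    { destruct (classic (in_oI x)) as [Ho|Ho]; [exists (G x); apply HF, Ho|].
      apply ex_RInt_ext with (f := fun _ => 0); [|apply ex_RInt_const].
      intros z _. change (0 = F x z). unfold F, ind_Omega. unfold in_oI in Ho.
      destruct (Rlt_dec (-1) x); [destruct (Rlt_dec x 1); [lra|]|]; ring. }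
    exists (ex_RInt_Reals_0 _ _ _ Hex). symmetry; apply RInt_Reals.
  - assert (HFG : forall x, in_oI x -> G x = RInt (F x) (-1) 0)
      by (intros x Hx; symmetry; apply (@is_RInt_unique R_CompleteNormedModule), HF, Hx).
    assert (Hex : ex_RInt (fun x => RInt (F x) (-1) 0) (-1) 1).
    { apply ex_RInt_ext with (f := G); [|apply continuity_ex_RInt, HG].
      rewrite Rmin_left, Rmax_right by lra. intros x Hx; apply HFG, Hx. }
    exists (ex_RInt_Reals_0 _ _ _ Hex). rewrite <- RInt_Reals.
    apply Rle_trans with (RInt (fun _ => s + 3 * d / m + 8 * d) (-1) 1).
    + apply RInt_le; trivial; [lra | apply ex_RInt_const|].
      intros x Hx. rewrite <- (HFG x Hx). apply HGb, Hx.
    + rewrite RInt_const. unfold scal; simpl; unfold mult; simpl. lra.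
Qed.

(** * Assembly of the estimates for the given family *)

Lemma solution_near (r0 alpha lam mu kappa0 eps : R) (u u1 u2 v v1 v2 : R -> R) (phi : R -> R -> R) :
  0 < lam -> 0 < mu -> 0 < kappa0 < 1 / 3 -> 0 < eps <= 3 * kappa0 / 20 ->
  is_solution eps lam mu u u1 u2 v v1 v2 phi ->
  sol_props r0 alpha kappa0 u u1 u2 v v1 v2 ->
  near_solution (3 * kappa0) lam mu ((lam + mu) * (1546 / (3 * kappa0) ^ 4) * eps ^ 2) u u1 u2 v v1 v2 /\
  cont2_on (in_clOmega u v) phi /\
  forall x z, in_clOmega u v x z ->
    Rabs (phi x z - psi u v x z) <= 118 / (3 * kappa0) ^ 3 * eps ^ 2.
Proof.
  intros Hlam Hmu Hk He (C2u & C2v & Hlt & Cphi & Hbd & (px & pz & pxx & pzz & HL & _ & _ & Cpx & Cpz & Hu2 & Hv2) & B1 & B2 & B3 & B4)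
    (_ & _ & Hev & _ & _ & _ & Hb & Hw).
  (* The gap is at least [(-1/3 + kappa0) - (-1/3 - 2 * kappa0)]. *)
  set (m := 3 * kappa0) in *.
  assert (Hm : 0 < m <= 1) by (unfold m; lra).
  assert (Hp : profile m u u1 u2 v v1 v2).
  { split; [trivial|]. split; [trivial|]. split; [trivial|]. split.
    - intros x Hx; destruct (Hb x Hx) as (? & ? & ? & ?); unfold m; lra.
    - intros x Hx; destruct (Hw x Hx) as (? & ? & ? & ? & ? & ?); auto. }
  (* This one threshold covers both [354 * eps ^ 2 <= m ^ 2] and [eps ^ 2 <= 1 / 24]. *)
  assert (He2 : 0 < eps ^ 2 <= m ^ 2 / 400) by (split; [apply pow_lt; lra | nra]).
  assert (Hm2 : m ^ 2 <= 1) by nra.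
  assert (H0 : in_oI 0) by (unfold in_oI; lra).
  split; [|split; trivial].
  - split; [trivial|]. repeat (split; [assumption|]).
    split; [apply (derivable_pt_lim_even u); [apply Hev | apply C2u, H0]|].
    split; [apply (derivable_pt_lim_even v); [apply Hev | apply C2v, H0]|].
    intros x Hx.
    destruct (curvature_near m (eps ^ 2) lam mu u u1 u2 v v1 v2 phi px pz pxx pzz Hp Hlam Hmu)
      with (x := x) as [K1 K2]; trivial; try lra.
    assert (P4 : 0 < 1546 / m ^ 4) by (apply Rdiv_lt_0_compat; [lra | apply pow_lt; lra]).
    assert (0 < 1546 / m ^ 4 * eps ^ 2) by (apply Rmult_lt_0_compat; lra).
    split; nra.
  - intros x z Hxz.
    assert (K := phi_minus_psi m (eps ^ 2) u u1 u2 v v1 v2 phi px pz pxx pzz Hp ltac:(lra) Cphi Hbd HL x z Hxz).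
    apply Rle_trans with (1 := K).
    rewrite <- (Rmult_1_r (118 / m ^ 3 * eps ^ 2)) at 2.
    assert (P3 : 0 < 118 / m ^ 3) by (apply Rdiv_lt_0_compat; [lra | apply pow_lt; lra]).
    apply Rmult_le_compat_l; [apply Rmult_le_pos; lra|].
    destruct Hxz as [Hx Hz]. destruct (proj1 (proj2 (proj2 (proj2 Hp))) x Hx).
    unfold bump; nra.
Qed.

Lemma iter_int_le_weaken (F : R -> R -> R) (a b c d eta eta' : R) : eta <= eta' ->
  iter_int_le F a b c d eta -> iter_int_le F a b c d eta'.
Proof.
  intros H (G & HG & pr & Hpr). exists G; split; [trivial|].
  exists pr; apply Rle_trans with (1 := Hpr) (2 := H).
Qed.

Lemma Un_cv_subsequence (f : nat -> R) (s : nat -> nat) (l : R) :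
  (forall n, (n <= s n)%nat) -> Un_cv f l -> Un_cv (fun n => f (s n)) l.
Proof.
  intros Hs Hf eta He. destruct (Hf eta He) as [N HN].
  exists N; intros n Hn. apply HN. specialize (Hs n); lia.
Qed.

Theorem theorem2 (r0 alpha a0 lam mu kappa0 : R)
  (u u1 u2 v v1 v2 : R -> R -> R) (phi : R -> R -> R -> R) :
  0 < r0 < 2/3 -> 0 <= alpha < 1 -> 0 < a0 ->
  0 < lam <= a0 -> 0 < mu <= a0 -> 0 < kappa0 < 1/3 ->
  (forall eps, 0 < eps < 1 ->
     is_solution eps lam mu (u eps) (u1 eps) (u2 eps) (v eps) (v1 eps) (v2 eps) (phi eps) /\
     sol_props r0 alpha kappa0 (u eps) (u1 eps) (u2 eps) (v eps) (v1 eps) (v2 eps)) ->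
  exists epsk : nat -> R,
    (forall k, 0 < epsk k < 1) /\ Un_cv epsk 0 /\
    exists u0 u01 u02 v0 v01 v02 : R -> R,
      small_aspect_sol lam mu u0 u01 u02 v0 v01 v02 /\
      W1inf_cv (fun k => u (epsk k)) (fun k => u1 (epsk k)) u0 u01 /\
      W1inf_cv (fun k => v (epsk k)) (fun k => v1 (epsk k)) v0 v01 /\
      L2_cv (fun k x z => phi (epsk k) x z * ind_Omega (u (epsk k)) (v (epsk k)) x z)
            (fun x z => (z - v0 x) / (u0 x - v0 x) * ind_Omega u0 v0 x z).
Proof.
  intros _ _ _ [Hlam _] [Hmu _] Hk H.
  set (m := 3 * kappa0).
  assert (Hm : 0 < m <= 1) by (unfold m; lra).
  (* The factor [m / 20] keeps every term below the threshold of [solution_near]. *)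
  set (base := fun n => m / 20 * / (INR n + 1)).
  assert (Hinv : forall n, 0 < / (INR n + 1) <= 1).
  { intros n; assert (P := pos_INR n). split; [apply Rinv_0_lt_compat; lra|].
    rewrite <- Rinv_1; apply Rinv_le_contravar; lra. }
  assert (Hbase : forall n, 0 < base n <= m / 20).
  { intros n; unfold base; specialize (Hinv n). set (q := / (INR n + 1)) in *; split; nra. }
  assert (Hsol : forall n, near_solution m lam mu ((lam + mu) * (1546 / m ^ 4) * base n ^ 2)
       (u (base n)) (u1 (base n)) (u2 (base n)) (v (base n)) (v1 (base n)) (v2 (base n)) /\
     cont2_on (in_clOmega (u (base n)) (v (base n))) (phi (base n)) /\
     forall x z, in_clOmega (u (base n)) (v (base n)) x z ->
       Rabs (phi (base n) x z - psi (u (base n)) (v (base n)) x z) <= 118 / m ^ 3 * base n ^ 2).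
  { intros n. assert (Hn := Hbase n). destruct (H (base n)) as [S1 S2]; [lra|].
    apply (solution_near r0 alpha); trivial. }
  assert (Hprof : forall n, profile m (u (base n)) (u1 (base n)) (u2 (base n)) (v (base n)) (v1 (base n)) (v2 (base n)))
    by (intros n; apply Hsol).
  assert (H0 : in_I 0) by (unfold in_I; lra).
  assert (H01 : forall n, -1 <= u (base n) 0 <= 0 /\ -1 <= v (base n) 0 <= 0).
  { intros n. destruct (Hprof n) as (_ & _ & _ & P & _). specialize (P 0 H0); lra. }
  (* Only two real sequences need extraction, the values at 0: first for [u], then for [v] along the
     first selection. *)
  destruct (bounded_cv_subsequence (fun n => u (base n) 0) (-1) 0) as (s1 & lu & Hs1 & Hlu);
    [intros n; apply H01|].
  destruct (bounded_cv_subsequence (fun n => v (base (s1 n)) 0) (-1) 0) as (s2 & lv & Hs2 & Hlv);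
    [intros n; apply H01|].
  set (s := fun n => s1 (s2 n)).
  assert (Hs : forall n, (n <= s n)%nat) by (intros n; unfold s; specialize (Hs1 (s2 n)); specialize (Hs2 n); lia).
  assert (Hcv : Un_cv (fun n => base (s n)) 0).
  { apply (Un_cv_subsequence base s 0 Hs).
    intros eta He. destruct (archimed_cor1 eta He) as (N & HN & HN0).
    exists N; intros n Hn. assert (B := Hbase n). unfold R_dist.
    rewrite Rminus_0_r, Rabs_pos_eq by lra.
    apply Rle_lt_trans with (2 := HN).
    apply Rle_trans with (/ (INR n + 1)).
    - unfold base; specialize (Hinv n). set (q := / (INR n + 1)) in *; nra.
    - apply Rinv_le_contravar; [apply lt_0_INR; trivial|]. apply le_INR in Hn; lra. }
  assert (Hsmall : forall c d, 0 < c -> 0 < d -> exists N, forall k, (N <= k)%nat -> c * base (s k) ^ 2 <= d).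
  { intros c d Hc Hd. destruct (Hcv (d / c)) as [N HN]; [apply Rdiv_lt_0_compat; trivial|].
    exists N; intros k Hkk. specialize (HN k Hkk). unfold R_dist in HN.
    assert (B := Hbase (s k)). rewrite Rminus_0_r, Rabs_pos_eq in HN by lra.
    apply Rle_trans with (c * (d / c)); [|right; field; lra].
    apply Rmult_le_compat_l; [lra|]. nra. }
  assert (P4 : 0 < (lam + mu) * (1546 / m ^ 4))
    by (apply Rmult_lt_0_compat; [lra|]; apply Rdiv_lt_0_compat; [lra | apply pow_lt; lra]).
  assert (P3 : 0 < 118 / m ^ 3) by (apply Rdiv_lt_0_compat; [lra | apply pow_lt; lra]).
  exists (fun n => base (s n)). split; [|split; [trivial|]].
  { intros k; assert (B := Hbase (s k)); lra. }
  destruct (near_solutions_limit m lam mu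
    (fun k => u (base (s k))) (fun k => u1 (base (s k))) (fun k => u2 (base (s k)))
    (fun k => v (base (s k))) (fun k => v1 (base (s k))) (fun k => v2 (base (s k))) Hlam Hmu)
    as (u0 & u01 & u02 & v0 & v01 & v02 & Hsm & Wu & Wv & Hlim).
  - intros k; apply Hprof.
  - intros k. destruct (Hsol (s k)) as ((_ & ? & ? & ? & ? & _) & _); auto.
  - intros d Hd. destruct (Hsmall _ d P4 Hd) as [N HN]. exists N; intros k Hkk.
    apply near_solution_weaken with (1 := HN k Hkk). apply Hsol.
  - apply CV_Cauchy. exists lu. apply (Un_cv_subsequence (fun n => u (base (s1 n)) 0) s2); trivial.
  - apply CV_Cauchy. exists lv. exact Hlv.
  - exists u0, u01, u02, v0, v01, v02. repeat (split; [assumption|]).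
    intros eta He.
    (* The first bound gives [3 * d / m <= 1 / 2], matching [c <= 1 / 2] below. By the second and
       [d <= d / m], [2 * (c + 3 * d / m + 8 * d) <= 2 * (eta / 4) + 22 * (eta / 44) = eta]. *)
    set (d := Rmin (m / 6) (eta * m / 44)).
    assert (Hd : 0 < d) by (apply Rmin_glb_lt; nra).
    assert (D1 : d <= m / 6) by apply Rmin_l. assert (D2 : d <= eta * m / 44) by apply Rmin_r.
    set (c := Rmin (1 / 2) (eta / 4)).
    assert (Hc : 0 < c) by (apply Rmin_glb_lt; lra).
    assert (C1 : c <= 1 / 2) by apply Rmin_l. assert (C2 : c <= eta / 4) by apply Rmin_r.
    destruct (Wu d Hd) as [N1 HN1]. destruct (Wv d Hd) as [N2 HN2].
    destruct (Hsmall _ c P3 Hc) as [N3 HN3].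
    exists (max N1 (max N2 N3)); intros k Hkk.
    destruct (Hsol (s k)) as (_ & Cphi & Hphi).
    assert (E1 : 3 * d / m <= 1 / 2).
    { apply Rmult_le_reg_r with m; [lra|]. unfold Rdiv at 1. rewrite Rmult_assoc, Rinv_l; lra. }
    assert (E2 : d / m <= eta / 44).
    { apply Rmult_le_reg_r with m; [lra|]. unfold Rdiv at 1. rewrite Rmult_assoc, Rinv_l; lra. }
    assert (E3 : d <= d / m).
    { apply Rmult_le_reg_r with m; [lra|]. unfold Rdiv. rewrite Rmult_assoc, Rinv_l; nra. }
    apply iter_int_le_weaken with (2 * (c + 3 * d / m + 8 * d)).
    + replace (3 * d / m) with (3 * (d / m)) by (unfold Rdiv; ring). lra.
    + apply (L2_estimate m d c _ _ _ _ _ _ u0 v0 (phi (base (s k))) (Hprof (s k))); trivial.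
      * apply Hsm.
      * apply Hsm.
      * intros x z Hxz. apply Rle_trans with (1 := Hphi x z Hxz). apply HN3; lia.
      * intros x Hx; split; [apply HN1 | apply HN2]; trivial; lia.
      * lra.
      * lra.
Qed.
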